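(* For every ordinal $\alpha$ with $\omega+2\le\alpha\le\omega_1^{\mathrm{ck}}$, the class $\mathrm{NP}_\alpha$ equals the class $\Sigma^1_1$ of lightface analytic sets of reals, and $\text{co-NP}_\alpha$ equals the class of lightface $\Pi^1_1$ sets. In particular $\mathrm{NP}=\mathrm{NP}_{\omega+2}$, and $\mathrm{NP}\cap\text{co-NP}$ is exactly the class $\Delta^1_1$ of lightface hyperarithmetic sets of reals.
   Context: Infinite time Turing machines (ITTMs) have the hardware of a classical Turing machine with finitely many semi-infinite binary tapes, one head and a finite program, run in transfinite ordinal time: successor steps as classically; at limit stages the head returns to the leftmost cell, the machine enters a special limit state, and each cell takes the $\limsup$ of its earlier values. Reals are elements of Cantor space ${}^\omega 2=\mathbb{R}$. Deciding machines have halting states accept and reject; halting in $\alpha$ steps means the $\alpha$-th step enters a halting state. Witnesses for nondeterministic classes are on a separate input tape. For an ordinal $\alpha$: $A\in P_\alpha$ iff some machine $T$ and some $\beta<\alpha$ are such that $T$ decides $A$ and halts on every input in fewer than $\beta$ steps; $A\in\mathrm{NP}_\alpha$ iff there are $T$ and $\beta<\alpha$ with $x\in A\iff\exists y\in\mathbb{R}\,(T$ accepts $(x,y))$ and $T$ halting on every input $(x,y)$ in fewer than $\beta$ steps; $\text{co-NP}_\alpha$ consists of complements of sets in $\mathrm{NP}_\alpha$. $\mathrm{NP}=\mathrm{NP}_{\omega^\omega}$, $\text{co-NP}=\text{co-NP}_{\omega^\omega}$. $\omega_1^{\mathrm{ck}}$ is the supremum of the recursive ordinals. *)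

(* Defs.v *)
From mathcomp Require Import all_boot.
From mathcomp Require Import boolp classical_sets.

Set Implicit Arguments.
Unset Strict Implicit.
Unset Printing Implicit Defensive.

Local Open Scope classical_set_scope.

(* Ordinals: [Sup f] denotes the least ordinal strictly above every [f a].    *)
(* Different trees may denote the same ordinal, so the equality of ordinals   *)
(* is [oeq] and not [=].                                                      *)
Inductive ord : Type := Sup (A : Type) (f : A -> ord).

Definition idx (a : ord) : Type := let: @Sup A _ := a in A.
Definition child (a : ord) : idx a -> ord :=
  match a return idx a -> ord with Sup _ f => f end.

Fixpoint ole (a b : ord) : Prop :=
  match a with
  | Sup _ f => forall i, exists j : idx b, ole (f i) (child j)
  end.

Definition olt (a b : ord) : Prop := exists j : idx b, ole a (child j).
Definition oeq (a b : ord) : Prop := ole a b /\ ole b a.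

Definition ozero : ord := Sup (of_void ord).
Definition osucc (a : ord) : ord := Sup (fun _ : unit => a).
Definition onat (n : nat) : ord := iter n osucc ozero.
Definition omega : ord := Sup onat.
Definition olimit (a : ord) : Prop :=
  olt ozero a /\ forall b, olt b a -> olt (osucc b) a.

Definition osup (I : Type) (F : I -> ord) : ord :=
  Sup (fun p : {i : I & idx (F i)} => child (projT2 p)).

(* a + b = sup of all (a' + 1), a' < a, and all (a + b') + 1, b' < b.         *)
Fixpoint oadd (a b : ord) : ord :=
  match b with
  | Sup B g => Sup (fun s : idx a + B =>
      match s with inl i => child i | inr j => oadd a (g j) end)
  end.

(* a * b = sup of all (a * b' + a') + 1, a' < a, b' < b.                      *)
Fixpoint omul (a b : ord) : ord :=
  match b with
  | Sup B g => Sup (fun p : idx a * B => oadd (omul a (g p.2)) (child p.1))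
  end.

(* Intended for a > 0: a ^ b = max of 1 and the sup of all a ^ b' * a, b' < b *)
Fixpoint oexp (a b : ord) : ord :=
  match b with
  | Sup B g => osup (fun o : option B =>
      match o with None => onat 1 | Some j => omul (oexp a (g j)) a end)
  end.

Fixpoint acc_rank (T : Type) (R : T -> T -> Prop) (x : T) (h : Acc R x) : ord :=
  match h with
  | Acc_intro h' => Sup (fun y : {y | R y x} => acc_rank (h' _ (proj2_sig y)))
  end.

(* The order type of R when R is a strict linear order.                       *)
Definition otype (T : Type) (R : T -> T -> Prop) (wf : well_founded R) : ord :=
  Sup (fun x => acc_rank (wf x)).

(* Kleene's recursive functions: minimization is applied to regular           *)
(* functions only, so that all the functions are total.                       *)
Inductive recursive : forall n, (n.-tuple nat -> nat) -> Prop :=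
| rec_zero n (h : n.-tuple nat -> nat) :
    (forall v, h v = 0) -> recursive h
| rec_succ (h : 1.-tuple nat -> nat) :
    (forall v, h v = (thead v).+1) -> recursive h
| rec_proj n (i : 'I_n) (h : n.-tuple nat -> nat) :
    (forall v, h v = tnth v i) -> recursive h
| rec_comp m n (f : m.-tuple nat -> nat) (g : 'I_m -> n.-tuple nat -> nat)
    (h : n.-tuple nat -> nat) :
    recursive f -> (forall i, recursive (g i)) ->
    (forall v, h v = f [tuple g i v | i < m]) -> recursive h
| rec_prim n (f : n.-tuple nat -> nat) (g : n.+2.-tuple nat -> nat)
    (h : n.+1.-tuple nat -> nat) :
    recursive f -> recursive g ->
    (forall v : n.-tuple nat, h [tuple of 0 :: v] = f v) ->
    (forall k (v : n.-tuple nat), h [tuple of k.+1 :: v] =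
       g [tuple of k :: h [tuple of k :: v] :: v]) -> recursive h
| rec_mu n (g : n.+1.-tuple nat -> nat) (h : n.-tuple nat -> nat) :
    recursive g ->
    (forall v : n.-tuple nat, g [tuple of h v :: v] = 0 /\
               forall k, k < h v -> g [tuple of k :: v] <> 0) -> recursive h.

Definition recursive_set (D : nat -> bool) : Prop :=
  recursive (fun v : 1.-tuple nat => nat_of_bool (D (thead v))).
Definition recursive_rel (R : nat -> nat -> bool) : Prop :=
  recursive (fun v : 2.-tuple nat =>
    nat_of_bool (R (tnth v ord0) (tnth v ord_max))).

Record recursive_wo := RecursiveWO {
  wo_dom : nat -> bool;
  wo_rel : nat -> nat -> bool;
  wo_lt (m n : {n | wo_dom n}) : Prop := wo_rel (val m) (val n);
  wo_dom_rec : recursive_set wo_dom;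
  wo_rel_rec : recursive_rel wo_rel;
  wo_trans : forall m n p, wo_lt m n -> wo_lt n p -> wo_lt m p;
  wo_total : forall m n, m = n \/ wo_lt m n \/ wo_lt n m;
  wo_wf : well_founded wo_lt
}.

Definition omega1ck : ord := osup (fun W : recursive_wo => otype (@wo_wf W)).

Definition real : Type := nat -> bool.
Definition blank : real := fun _ => false.

Inductive move := MoveL | MoveR.

(* Tape 0 is the input tape, tape 1 the witness tape. The single head reads   *)
(* and writes the cells at its position on all tapes at once.                 *)
Record ittm := ITTM {
  ittm_work : nat;
  ntapes : nat := ittm_work.+2;
  ittm_state : finType;
  q_start : ittm_state;
  q_limit : ittm_state;
  q_accept : ittm_state;
  q_reject : ittm_state;
  ittm_uniq : uniq [:: q_start; q_limit; q_accept; q_reject];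
  ittm_trans : ittm_state -> ntapes.-tuple bool ->
               ittm_state * ntapes.-tuple bool * move
}.

Record config (T : ittm) := Config {
  c_state : ittm_state T;
  c_head : nat;
  c_tape : 'I_(ntapes T) -> real
}.

Definition init_config (T : ittm) (x y : real) : config T :=
  Config (q_start T) 0 (fun i => nth blank [:: x; y] i).

Definition halted (T : ittm) (c : config T) : bool :=
  c_state c \in [:: q_accept T; q_reject T].

(* A left move on the leftmost cell leaves the head where it is.              *)
Definition step (T : ittm) (c : config T) : config T :=
  let p := c_head c in
  let: (q, w, d) :=
    ittm_trans (c_state c) [tuple c_tape c i p | i < ntapes T] in
  Config q (match d with MoveL => p.-1 | MoveR => p.+1 end)
    (fun i n => if n == p then tnth w i else c_tape c i n).

(* A limsup of bits is 1 iff the bit 1 occurs cofinally often.                *)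
Definition limit_config (T : ittm) (a : ord) (h : ord -> config T) : config T :=
  Config (q_limit T) 0 (fun i n =>
    `[< forall b, olt b a ->
        exists g, [/\ ole b g, olt g a & c_tape (h g) i n] >]).

(* [stage T x y a c]: the computation on (x, y) reaches stage a, where the    *)
(* configuration is c. There is no stage after a halting one.                 *)
Inductive stage (T : ittm) (x y : real) : ord -> config T -> Prop :=
| stage_zero a : oeq a ozero -> stage x y a (init_config T x y)
| stage_succ a b c : oeq a (osucc b) -> stage x y b c -> ~~ halted c ->
    stage x y a (step c)
| stage_limit a h : olimit a -> (forall b, olt b a -> stage x y b (h b)) ->
    stage x y a (limit_config a h).

(* The g-th step leads from stage g to stage g + 1; thus step omega is the    *)
(* transition made from the limit state at stage omega.                       *)
Definition halts_in (T : ittm) (x y : real) (g : ord) : Prop :=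
  exists c : config T, stage x y (osucc g) c /\ halted c.

Definition accepts (T : ittm) (x y : real) : Prop :=
  exists (a : ord) (c : config T), stage x y a c /\ c_state c = q_accept T.

Definition NP_ (a : ord) : set (set real) :=
  [set A | exists (T : ittm) (b : ord),
    [/\ olt b a,
        forall x y, exists g, olt g b /\ halts_in T x y g
      & forall x, A x <-> exists y, accepts T x y]].

Definition coNP_ (a : ord) : set (set real) := [set A | NP_ a (~` A)].

Definition NP : set (set real) := NP_ (oexp omega omega).
Definition coNP : set (set real) := coNP_ (oexp omega omega).

(* Arithmetical formulas of second-order arithmetic: only number variables    *)
(* are quantified. Both sorts of variables are named by natural numbers.      *)
Inductive term :=
| TVar (v : nat)
| TZero
| TOne
| TAdd (s t : term)
| TMul (s t : term).

Inductive arith :=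
| FEq (s t : term)
| FLt (s t : term)
| FIn (t : term) (X : nat)
| FNot (p : arith)
| FAnd (p q : arith)
| FAll (v : nat) (p : arith).

Fixpoint teval (e : nat -> nat) (t : term) : nat :=
  match t with
  | TVar v => e v
  | TZero => 0
  | TOne => 1
  | TAdd s t => teval e s + teval e t
  | TMul s t => teval e s * teval e t
  end.

Fixpoint sat (X : nat -> real) (e : nat -> nat) (p : arith) : Prop :=
  match p with
  | FEq s t => teval e s = teval e t
  | FLt s t => teval e s < teval e t
  | FIn t i => X i (teval e t)
  | FNot p => ~ sat X e p
  | FAnd p q => sat X e p /\ sat X e q
  | FAll v p => forall n, sat X [eta e with v |-> n] p
  end.

(* Set variable 0 stands for x and set variable 1 for y. All other free       *)
(* variables get the value 0 or the empty set, so there are no parameters.    *)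
Definition sat2 (p : arith) (x y : real) : Prop :=
  sat (nth blank [:: x; y]) (fun _ => 0) p.

Definition Sigma11 : set (set real) :=
  [set A | exists p, forall x, A x <-> exists y, sat2 p x y].
Definition Pi11 : set (set real) :=
  [set A | exists p, forall x, A x <-> forall y, sat2 p x y].
Definition Delta11 : set (set real) := Sigma11 `&` Pi11.

(* Main.v *)
(* From [Sigma11] to machines: the witness codes, besides the set y, the truth *)
(* value of every formula under every assignment. That such a table is        *)
(* coherent has the form "for all s there is m such that Theta(s, m)" with    *)
(* Theta bounded, increasing in m and decreasing in s. A machine that         *)
(* evaluates Theta(s, m) for m = 0, 1, 2, ..., increasing s at each success,  *)
(* succeeds infinitely often iff the table is coherent; it signals each       *)
(* success in the first cell of a tape, whose limsup it reads at stage omega. *)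
(*                                                                            *)
(* From machines to [Sigma11]: the witness codes y together with a computation*)
(* along a well-order on numbers that is longer than the time bound. Such a   *)
(* well-order is pinned down arithmetically by guessing the graphs of the     *)
(* recursive functions that define it; this uses no coding of sequences, as   *)
(* the guessed sets are only subject to the recursion equations. For bounds   *)
(* below omega ^ omega, the well-orders omega ^ j are definable outright.     *)

Require Import Defs.
From mathcomp Require Import all_boot.
From mathcomp Require Import boolp classical_sets.
From mathcomp Require Import zify.

Set Implicit Arguments.
Unset Strict Implicit.
Unset Printing Implicit Defensive.

Local Open Scope classical_set_scope.

(** * Ordinals and stages *)

Arguments ole : simpl never.
Arguments osucc : simpl never.

(** Everything follows from [NP_eq]: the class for a bound [a] is [Sigma11] as soon as [a] exceeds
    omega + 1 and is [covered], that is, cofinally approximated by ordinals with arithmetically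
    definable notation systems. The co-classes follow by complementation ([Pi11_setC]), and classes
    for different bounds agree because each is [Sigma11].

    Lower bound ([Sigma11_NP]). One step after stage omega a machine can read a limsup, so it
    decides any condition that a search satisfies infinitely often, in particular a condition of the
    form: for all s there is m. An arithmetical matrix has more quantifier alternations, but the
    witness may carry its full truth table: coherence of a table has this form, and coherent tables
    are exactly the correct ones ([cond_sound], [cond_complete]). [often_successful] turns the
    condition into infinitely many successes of one search, which [loop_accepts] runs on a machine,
    programmed through counter machines and structured commands.

    Upper bound ([NP_Sigma11]). If all runs stop before b, acceptance means that some run, laid out
    along a well-order longer than b, reaches the accepting state. Being such a run is a local
    condition at the least node, at successors and at limits, hence arithmetical ([run_sound],
    [run_complete]). Well-foundedness itself is not arithmetical, but the order is not guessed
    freely: an arithmetical formula forces every solution to be a notation system for one fixed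
    ordinal. For recursive well-orders this comes from implicit definitions of recursive functions
    ([recursive_defines], [defines_wo]), for omega ^ j from lexicographic products
    ([defines_mul_omega]). *)

Lemma ole_refl a : ole a a.
Proof. by elim: a => A f IH i; exists i; exact: IH. Qed.

Lemma ole_trans b a c : ole a b -> ole b c -> ole a c.
Proof.
elim: a b c => A f IH [B g] c lab lbc i; have [j lij] := lab i.
by have [k ljk] := lbc j; exists k; apply: IH ljk.
Qed.

Lemma olt_child a (i : idx a) : olt (child i) a.
Proof. by exists i; exact: ole_refl. Qed.

Lemma ole_ltP a b : ole a b <-> forall o, olt o a -> olt o b.
Proof.
split=> [lab o [i li]|h].
  by case: a lab i li => A f lab i li; have [j lj] := lab i; exists j; apply: ole_trans lj.
by case: a h => A f h i; apply: h; exists i; exact: ole_refl.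
Qed.

Lemma ole_childP a b : ole a b <-> forall i : idx a, olt (child i) b.
Proof. by case: a. Qed.

Lemma olt_le_trans b a c : olt a b -> ole b c -> olt a c.
Proof. by move=> lab /ole_ltP; apply. Qed.

Lemma ole_lt_trans b a c : ole a b -> olt b c -> olt a c.
Proof. by move=> lab [j lj]; exists j; apply: ole_trans lj. Qed.

Lemma ole_child b (j : idx b) : ole (child j) b.
Proof.
elim: b j => B g IH j /=; apply/ole_childP => k; exists j; exact: IH.
Qed.

Lemma oltW a b : olt a b -> ole a b.
Proof. by case=> j lj; apply: ole_trans (ole_child j). Qed.

Lemma olt_trans b a c : olt a b -> olt b c -> olt a c.
Proof. by move=> /oltW; apply: ole_lt_trans. Qed.

Lemma olt_irrefl a : ~ olt a a.
Proof.
elim: a => A f IH [j lj]; apply: (IH j); apply: olt_le_trans lj.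
exact: (@olt_child (Sup f) j).
Qed.

(** By excluded middle: a child of [a] that no child of [b] dominates is, by induction, strictly
    above every child of [b], hence at least [b]. *)
Lemma ole_total a b : ole a b \/ olt b a.
Proof.
elim: a b => A f IH b; apply: contrapT => /not_orP[nab nba]; apply: nab => i /=.
apply: contrapT => nij; apply: nba; exists i; apply/ole_childP => j.
by have [lij|//] := IH i (child j); case: nij; exists j.
Qed.

Lemma oltNge a b : olt a b <-> ~ ole b a.
Proof.
split=> [lab lba|nba]; first by apply: (@olt_irrefl a); apply: olt_le_trans lba.
by have [] := ole_total b a.
Qed.

Lemma oleNgt a b : ole a b <-> ~ olt b a.
Proof. by rewrite oltNge notK. Qed.

Lemma olt_ind (P : ord -> Prop) :
  (forall a, (forall b, olt b a -> P b) -> P a) -> forall a, P a.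
Proof.
move=> IHP a; suff: forall b, ole b a -> P b by apply; exact: ole_refl.
elim: a => A f IH b lb; apply: IHP => c /olt_le_trans/(_ lb) [j lj].
exact: IH lj.
Qed.

Lemma oeq_refl a : oeq a a.
Proof. by split; exact: ole_refl. Qed.

Lemma oeq_sym a b : oeq a b -> oeq b a.
Proof. by case. Qed.

Lemma oeq_trans b a c : oeq a b -> oeq b c -> oeq a c.
Proof.
move=> [ab ba] [bc cb].
by split; [exact: ole_trans bc|exact: ole_trans ba].
Qed.

Lemma olt_eql a a' b : oeq a a' -> olt a b -> olt a' b.
Proof. by case=> _ h; apply: ole_lt_trans. Qed.

Lemma olt_eqr a b b' : oeq b b' -> olt a b -> olt a b'.
Proof. by case=> h _ /olt_le_trans; apply. Qed.

Lemma ole_eqVlt a b : ole a b -> oeq a b \/ olt a b.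
Proof. by move=> lab; have [lba|] := ole_total b a; [left|right]. Qed.

Lemma olt_succ a : olt a (osucc a).
Proof. by exists tt; exact: ole_refl. Qed.

Lemma olt_succP a b : olt a (osucc b) <-> ole a b.
Proof. by split=> [[[]]|] //; exists tt. Qed.

Lemma ole_succP a b : ole (osucc a) b <-> olt a b.
Proof. by split=> [|h []] //; apply; exact: tt. Qed.

Lemma olt_zero a : ~ olt a ozero.
Proof. by case; case. Qed.

Lemma ole0 a : ole ozero a.
Proof. by case. Qed.

Lemma ord_cases a :
  [\/ oeq a ozero, exists b, oeq a (osucc b) | olimit a].
Proof.
have [a0|] := ole_total a ozero; first by constructor 1; split=> //; exact: ole0.
move=> a0; have [[b ab]|nb] := pselect (exists b, oeq a (osucc b)).
  by constructor 2; exists b.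
constructor 3; split=> // b ba; have [h|//] := ole_total a (osucc b).
by case: nb; exists b; split=> //; apply/ole_succP.
Qed.

Lemma olimit_eq a b : oeq a b -> olimit a -> olimit b.
Proof.
move=> ab [a0 h]; split=> [|c cb]; first exact: olt_eqr a0.
by apply: (olt_eqr ab); apply: h; apply: (olt_eqr (oeq_sym ab)).
Qed.

Lemma olimit_not_zero a : olimit a -> ~ oeq a ozero.
Proof. by move=> [a0 _] [/(olt_le_trans a0)/olt_irrefl]. Qed.

Lemma succ_not_zero a b : oeq a (osucc b) -> ~ oeq a ozero.
Proof. by move=> [_ /ole_succP h] [/(olt_le_trans h)/olt_zero]. Qed.

Lemma olimit_not_succ a b : olimit a -> ~ oeq a (osucc b).
Proof.
move=> [_ h] [l /ole_succP/h]; by move/olt_le_trans/(_ l)/olt_irrefl.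
Qed.

Lemma osucc_inj a b : oeq (osucc a) (osucc b) -> oeq a b.
Proof. by move=> [/ole_succP/olt_succP ? /ole_succP/olt_succP ?]. Qed.

Lemma olt_supP I (F : I -> ord) a : olt a (osup F) <-> exists i, olt a (F i).
Proof.
split=> [[[i k] h]|[i [k h]]]; first by exists i; exists k.
by exists (existT _ i k).
Qed.

Lemma olt_onat m n : olt (onat m) (onat n) <-> (m < n)%N.
Proof.
elim: n m => [|n IH] m; first by split=> // /olt_zero.
rewrite /= olt_succP; case: m => [|m]; first by split=> // _; exact: ole0.
by rewrite /= ole_succP IH ltnS.
Qed.

Lemma ole_onat m n : ole (onat m) (onat n) <-> (m <= n)%N.
Proof. by rewrite oleNgt olt_onat (leqNgt m n); split=> /negP. Qed.

Lemma ole_onatP a n : ole a (onat n) <-> exists2 m, (m <= n)%N & oeq a (onat m).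
Proof.
split=> [|[m mn [am _]]]; last by apply: ole_trans am _; apply/ole_onat.
elim: n => [|n IH] h; first by exists 0 => //; split=> //; exact: ole0.
have [e|/olt_succP/IH [m mn e]] := ole_eqVlt h; first by exists n.+1.
by exists m => //; exact: leqW.
Qed.

Lemma olt_omegaP a : olt a omega <-> exists n, oeq a (onat n).
Proof.
split=> [[n /ole_onatP [m _ h]]|[n [h _]]]; by [exists m|exists n].
Qed.

Lemma olimit_omega : olimit omega.
Proof.
split; first by apply/olt_omegaP; exists 0; exact: oeq_refl.
move=> b [n h]; exists n.+1; apply/ole_succP/olt_succP; exact: h.
Qed.

(** * Determinacy and existence of stages *)

Section Stages.
Variables (T : ittm) (x y : real).
Implicit Types (a b : ord) (c : config T).

(** Different trees may denote one ordinal, so stages have to be transported along [oeq]; at limits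
    this works because the limsup refers only to the order below. *)
Lemma stage_eq a b c : oeq a b -> stage x y a c -> stage x y b c.
Proof.
move=> ab h; case: h ab => {a c} [a|a d c|a h].
- by move=> a0 ab; apply: stage_zero; apply: oeq_trans a0; exact: oeq_sym.
- move=> ad sd nh ab; apply: stage_succ sd nh; apply: oeq_trans ad; exact: oeq_sym.
move=> la hs ab.
have -> : limit_config a h = limit_config b h.
  congr Config; apply/funext => i; apply/funext => n; apply: asbool_equiv_eq.
  split=> H o ob; have ba := oeq_sym ab.
    have [|g [og ga hg]] := H o; first exact: olt_eqr ob.
    by exists g; split=> //; exact: olt_eqr ga.
  have [|g [og ga hg]] := H o; first exact: olt_eqr ob.
  by exists g; split=> //; exact: olt_eqr ga.
apply: stage_limit; first exact: olimit_eq la.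
by move=> o ob; apply: hs; exact: (olt_eqr (oeq_sym ab)).
Qed.

Lemma stage_det a c : stage x y a c ->
  forall b c', oeq a b -> stage x y b c' -> c = c'.
Proof.
elim=> {a c} [a a0|a d c ad sd IH nh|a h la sh IH] b c' ab sb;
  case: sb ab => {b c'} [b b0|b e c' be se ne|b h' lb sh'] ab //.
- by case: (succ_not_zero be); apply: oeq_trans a0; exact: oeq_sym.
- by case: (olimit_not_zero lb); apply: oeq_trans a0; exact: oeq_sym.
- by case: (succ_not_zero ad); apply: oeq_trans b0.
- congr step; apply: IH se; apply: osucc_inj; apply: oeq_trans be.
  by apply: oeq_trans ab; exact: oeq_sym.
- by case: (olimit_not_succ lb (b := d)); apply: oeq_trans ad; exact: oeq_sym.
- by case: (olimit_not_zero la); apply: oeq_trans b0.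
- by case: (olimit_not_succ la (b := e)); apply: oeq_trans be.
congr Config; apply/funext => i; apply/funext => n; apply: asbool_equiv_eq.
have ba := oeq_sym ab.
have hE o : olt o a -> h o = h' o.
  move=> oa; apply: (IH _ oa o); first exact: oeq_refl.
  by apply: sh'; exact: olt_eqr oa.
split=> H o ob.
  have [|g [og ga hg]] := H o; first exact: olt_eqr ob.
  by exists g; split=> //; [exact: olt_eqr ga|rewrite -hE].
have [|g [og ga hg]] := H o; first exact: olt_eqr ob.
have ga' : olt g a by exact: olt_eqr ga.
by exists g; split=> //; rewrite hE.
Qed.

Lemma stage_before a c : stage x y a c ->
  forall b, olt b a -> exists2 c' : config T, stage x y b c' & ~~ halted c'.
Proof.
elim=> {a c} [a [a0 _]|a d c ad sd IH nh|a h [_ la] sh IH] b ba.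
- by case: (olt_zero (olt_le_trans ba a0)).
- have /olt_succP/ole_eqVlt [bd|/IH//] := olt_eqr ad ba.
  by exists c => //; apply: stage_eq sd; exact: oeq_sym.
(* That stage [b] is not halted is seen from stage [b] + 1, which is still below the limit. *)
- by apply: (IH _ (la _ ba)); exact: olt_succ.
Qed.

Lemma halted_stage_uniq a b c c' : stage x y a c -> stage x y b c' ->
  halted c -> halted c' -> oeq a b /\ c = c'.
Proof.
move=> sa sb ha hb.
have N d e (f f' : config T) : stage x y d f -> stage x y e f' -> halted f -> ~ olt d e.
  move=> sd se hf de; have [f2 sf2] := stage_before se de.
  by rewrite (stage_det sf2 (oeq_refl _) sd) hf.
have ab : oeq a b.
  by split; apply/oleNgt; [exact: N sb sa hb|exact: N sa sb ha].
by split=> //; exact: stage_det sa _ _ ab sb.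
Qed.

Lemma stage_exists a :
  (forall b (c : config T), olt b a -> stage x y b c -> ~~ halted c) ->
  exists c : config T, stage x y a c.
Proof.
elim/olt_ind: a => a IH nh.
have ex b : olt b a -> exists c : config T, stage x y b c.
  by move=> ba; apply: IH => // d c db; apply: nh; exact: olt_trans ba.
have [a0|[b ab]|la] := ord_cases a.
- by exists (init_config T x y); exact: stage_zero.
- have ba : olt b a by apply: olt_eqr (olt_succ b); exact: oeq_sym.
  have [c sc] := ex _ ba.
  by exists (step c); apply: (stage_succ ab sc); exact: nh sc.
have /choice [h hP] : forall b, exists c : config T, olt b a -> stage x y b c.
  move=> b; have [/ex [c sc]|nb] := pselect (olt b a); first by exists c.
  by exists (init_config T x y).
by exists (limit_config a h); exact: stage_limit.
Qed.

End Stages.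

(** * Counter machines *)

Definition upd (e : nat -> nat) (v n : nat) : nat -> nat :=
  fun i => if i == v then n else e i.

Lemma upd_same e v n : upd e v n v = n.
Proof. by rewrite /upd eqxx. Qed.

Lemma upd_diff e v n i : i != v -> upd e v n i = e i.
Proof. by rewrite /upd => /negbTE->. Qed.

(* A register with value n is a tape with exactly its first n cells marked.   *)
(* The register i is stored on tape i + 3; [ITest i t l1 l2] branches on the  *)
(* cell of tape t at the position given by the register i, which for          *)
(* t = j + 3 compares the registers i and j, and for t < 2 queries x or y.    *)
Inductive instr (L : Type) :=
| IInc (i : nat) (l : L)
| IZero (i : nat) (l : L)
| ITest (i t : nat) (l1 l2 : L).

Definition setw n (w : n.-tuple bool) (j : nat) (b : bool) : n.-tuple bool :=
  [tuple if val i == j then b else tnth w i | i < n].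

Section Counter.
Variables (L : finType) (l0 : L) (k : nat) (prog : L -> instr L) (fl : nat).

Definition cstate : finType := ((bool * bool) + (L + L))%type.
Definition qsweep (l : L) : cstate := inr (inl l).
Definition qback (l : L) : cstate := inr (inr l).

(** The start state puts the only mark on tape 2. A sweep walks right to the first unmarked cell of
    the register concerned, erasing on the way for [IZero], acts there and walks back. The limit
    state turns the first cell of the flag tape into acceptance or rejection. *)
Definition ctrans (q : cstate) (w : (k.+3).-tuple bool) :
    cstate * (k.+3).-tuple bool * move :=
  match q with
  | inl (true, true) => (qsweep l0, setw w 2 true, MoveL)
  | inl (true, false) =>
      (inl (false, nth false w fl.+3), w, MoveL)
  | inl _ => (q, w, MoveL)
  | inr (inl l) =>
      match prog l with
      | IInc i l' => if nth false w i.+3 then (q, w, MoveR)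
                     else (qback l', setw w i.+3 true, MoveL)
      | IZero i l' => if nth false w i.+3 then (q, setw w i.+3 false, MoveR)
                      else (qback l', w, MoveL)
      | ITest i t l1 l2 => if nth false w i.+3 then (q, w, MoveR)
                           else (qback (if nth false w t then l1 else l2), w, MoveL)
      end
  | inr (inr l) => if nth false w 2 then (qsweep l, w, MoveL) else (q, w, MoveL)
  end.

Lemma cstate_uniq :
  uniq [:: inl (true, true); inl (true, false); inl (false, true);
           inl (false, false) : cstate].
Proof. by []. Qed.

Definition cmachine : ittm := @ITTM k.+1 cstate _ _ _ _ cstate_uniq ctrans.

Variables x y : real.

Definition bit (s : nat -> nat) (t n : nat) : bool :=
  match t with
  | 0 => x n
  | 1 => y n
  | 2 => n == 0
  | j.+3 => n < s j
  end.

Definition mkc (q : cstate) (p : nat) (t : nat -> real) : config cmachine :=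
  @Config cmachine q p (fun i => t i).

Definition conf (l : L) (s : nat -> nat) : config cmachine :=
  mkc (qsweep l) 0 (bit s).

(* Under calm steps a clear register d stays clear; with d the flag, this     *)
(* bounds the limsup at stage omega.                                          *)
Definition calm (d : nat) (c : config cmachine) : bool :=
  match c_state c with
  | inr (inl l) => if prog l is IInc i _ then i != d else true
  | inr (inr _) => true
  | _ => false
  end.

(** The length is positive so that an endless sequence of rounds passes every finite time. *)
Definition reach (d : nat) (c c' : config cmachine) : Prop :=
  exists n, [/\ 0 < n, iter n (@step cmachine) c = c'
    & forall j, j < n -> calm d (iter j (@step cmachine) c)].

Lemma reach1 d c : calm d c -> reach d c (step c).
Proof. by move=> h; exists 1; split=> // -[]. Qed.

Lemma reach_trans d c2 c1 c3 : reach d c1 c2 -> reach d c2 c3 -> reach d c1 c3.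
Proof.
move=> [n [n0 e12 h12]] [m [m0 e23 h23]]; exists (m + n); split.
- by rewrite addn_gt0 n0 orbT.
- by rewrite iterD e12.
move=> j jmn; case: (ltnP j n) => [/h12//|nj].
by rewrite -(subnK nj) iterD e12; apply: h23; lia.
Qed.

Lemma nth_read (t : nat -> real) p j : j < k.+3 ->
  nth false [tuple t i p | i < k.+3] j = t j p.
Proof.
move=> jk; have := tnth_mktuple (fun i : 'I_k.+3 => t i p) (Ordinal jk).
by rewrite (tnth_nth false).
Qed.

Lemma step_mkc q p (t : nat -> real) q' w d : ctrans q [tuple t i p | i < k.+3] =
    (q', w, d) ->
  step (mkc q p t) = mkc q' (if d is MoveL then p.-1 else p.+1)
    (fun i n => if (n == p) && (i < k.+3) then nth false w i else t i n).
Proof.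
move=> e; rewrite /step /= e; congr Config.
apply/funext => i; apply/funext => n; rewrite (tnth_nth false).
by have -> : (i < k.+3) = true := ltn_ord i; rewrite andbT.
Qed.

Lemma mkc_ext q p t t' : (forall i n, i < k.+3 -> t i n = t' i n) ->
  mkc q p t = mkc q p t'.
Proof.
by move=> h; congr Config; apply/funext => i; apply/funext => n; apply: h.
Qed.

Lemma step_same q p (t : nat -> real) q' d :
  ctrans q [tuple t i p | i < k.+3] = (q', [tuple t i p | i < k.+3], d) ->
  step (mkc q p t) = mkc q' (if d is MoveL then p.-1 else p.+1) t.
Proof.
move=> /step_mkc->; apply: mkc_ext => i n ik; rewrite ik andbT.
by case: eqP => // ->; rewrite nth_read.
Qed.

Lemma step_set q p (t : nat -> real) q' d j b :
  ctrans q [tuple t i p | i < k.+3] =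
    (q', setw [tuple t i p | i < k.+3] j b, d) ->
  step (mkc q p t) = mkc q' (if d is MoveL then p.-1 else p.+1)
    (fun i n => if (n == p) && (i == j) then b else t i n).
Proof.
move=> /step_mkc->; apply: mkc_ext => i n ik; rewrite ik andbT.
have -> : nth false (setw [tuple t i p | i < k.+3] j b) i =
    if i == j then b else t i p.
  rewrite -[i in LHS]/(val (Ordinal ik)) -tnth_nth tnth_mktuple /=.
  by rewrite tnth_mktuple.
by case: (n =P p) => [->|//]; case: ifP.
Qed.

(* On the leftmost cell a left move keeps the head in place, so the head      *)
(* recognizes by the marker tape that it is home and starts the next sweep.   *)
Lemma go_back (d : nat) l p (t : nat -> real) : (forall n, t 2 n = (n == 0)) ->
  reach d (mkc (qback l) p t) (mkc (qsweep l) 0 t).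
Proof.
move=> t2; elim: p => [|p IH].
  have <- : step (mkc (qback l) 0 t) = mkc (qsweep l) 0 t.
    by apply: (@step_same _ _ _ _ MoveL); rewrite /= nth_read // t2.
  exact: reach1.
apply: reach_trans IH.
have <- : step (mkc (qback l) p.+1 t) = mkc (qback l) p t.
  by apply: (@step_same _ _ _ _ MoveL); rewrite /= nth_read // t2.
exact: reach1.
Qed.

Lemma sweep_last (d : nat) l l' q0 p (t t' : nat -> real) : calm d (mkc (qsweep l) q0 t) ->
  (forall n, t' 2 n = (n == 0)) ->
  step (mkc (qsweep l) p t) = mkc (qback l') p.-1 t' ->
  reach d (mkc (qsweep l) p t) (mkc (qsweep l') 0 t').
Proof.
move=> cm t2 e; apply: reach_trans (go_back d l' p.-1 t2).
by rewrite -e; exact: reach1.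
Qed.


Lemma reach_prefix (d : nat) (c : nat -> config cmachine) p :
  (forall n, n < p -> calm d (c n) /\ step (c n) = c n.+1) ->
  forall c', reach d (c p) c' -> reach d (c 0) c'.
Proof.
elim: p => [|p IH] h c' r //; have [cm e] := h _ (ltnSn p).
apply: IH => [n np|]; first by apply: h; exact: ltnW.
by apply: reach_trans r; rewrite -e; exact: reach1.
Qed.

Lemma inc_reach (d : nat) l i l' s : i < k -> i != d -> prog l = IInc i l' ->
  reach d (conf l s) (conf l' (upd s i (s i).+1)).
Proof.
move=> ik id e.
have cm p t : calm d (mkc (qsweep l) p t) by rewrite /calm /= e.
apply: (@reach_prefix d (fun p => mkc (qsweep l) p (bit s)) (s i)) => [p ps|].
  split; first exact: cm.
  by apply: (@step_same _ _ _ _ MoveR); rewrite /= e nth_read //= ps.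
apply: sweep_last (cm 0 _) _ _ => //.
rewrite (@step_set _ _ _ (qback l') MoveL i.+3 true); last first.
  by rewrite /= e nth_read //= ltnn.
apply: mkc_ext => -[|[|[|j]]] n _ //=; rewrite ?andbF ?eqSS //.
rewrite /upd; case: (j =P i) => [->|] /=; rewrite ?andbF // andbT ltnS.
by case: eqP; lia.
Qed.

Lemma zero_reach (d : nat) l i l' s : i < k -> prog l = IZero i l' ->
  reach d (conf l s) (conf l' (upd s i 0)).
Proof.
move=> ik e.
have cm p t : calm d (mkc (qsweep l) p t) by rewrite /calm /= e.
(* The tapes in mid-erasure: with the head at [p], the marks left of [p] are gone. *)
pose B p t n := if t == i.+3 then (p <= n < s i) else bit s t n.
have -> : conf l s = mkc (qsweep l) 0 (B 0).
  apply: mkc_ext => -[|[|[|j]]] n _ //; rewrite /B eqSS.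
  by case: eqP => // -[->].
apply: (@reach_prefix d (fun p => mkc (qsweep l) p (B p)) (s i)) => [p ps|].
  split; first exact: cm.
  rewrite (@step_set _ _ _ (qsweep l) MoveR i.+3 false); last first.
    by rewrite /= e nth_read //= /B eqxx leqnn ps.
  apply: mkc_ext => t n _ //=; rewrite /B.
  by case: (t =P i.+3) => [_|_]; rewrite ?andbF // andbT; case: (n =P p); lia.
have -> : conf l' (upd s i 0) = mkc (qsweep l') 0 (B (s i)).
  apply: mkc_ext => -[|[|[|j]]] n _ //; rewrite /B /= /upd !eqSS.
  by case: eqP => // _; rewrite ltn0; lia.
apply: sweep_last (cm 0 _) _ _ => //.
by apply: (@step_same _ _ _ _ MoveL); rewrite /= e nth_read //= /B eqxx ltnn andbF.
Qed.

Lemma test_reach (d : nat) l i t l1 l2 s : i < k -> t < k.+3 ->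
  prog l = ITest i t l1 l2 ->
  reach d (conf l s) (conf (if bit s t (s i) then l1 else l2) s).
Proof.
move=> ik tk e.
have cm p t' : calm d (mkc (qsweep l) p t') by rewrite /calm /= e.
apply: (@reach_prefix d (fun p => mkc (qsweep l) p (bit s)) (s i)) => [p ps|].
  split; first exact: cm.
  by apply: (@step_same _ _ _ _ MoveR); rewrite /= e nth_read //= ps.
apply: sweep_last (cm 0 _) _ _ => //.
by apply: (@step_same _ _ _ _ MoveL); rewrite /= e !nth_read //= ltnn.
Qed.

(** During sweeps and returns only an increment writes a mark, and calmness excludes the increment
    of [d]. *)
Lemma calm_tape d (i : 'I_k.+3) (c : config cmachine) : i = d.+3 :> nat ->
  calm d c -> ~~ c_tape c i 0 -> ~~ c_tape (step c) i 0.
Proof.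
rewrite /calm /step; case: c => q p t id /=.
case e: ctrans => [[q' w] dd] /= cm nf; case: (0 =P p) => [p0|//]; subst p.
move: e; have := tnth_mktuple (fun i => t i 0) i.
set w0 := [tuple t i 0 | i < _] => ew0.
have nw : ~~ tnth w0 i by rewrite ew0.
have nset j b : (j != d.+3) || ~~ b -> ~~ tnth (setw w0 j b) i.
  by rewrite tnth_mktuple /= id eq_sym; case: eqP => //=.
case: q cm => [[[] []]|[l|l]] /=.
- by [].
- by [].
- by [].
- by [].
- case: (prog l) => [j l'|j l'|j u l1 l2] jd; case: ifP => _ [_ <- _] //.
  + by apply: nset; rewrite !eqSS jd.
  + by apply: nset; rewrite orbT.
by move=> _; case: ifP => _ [_ <- _].
Qed.

End Counter.

(** * Structured programs and their compilation *)

Inductive cmd :=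
| CInc (i : nat)
| CZero (i : nat)
| CSeq (c1 c2 : cmd)
| CIf (i t : nat) (c1 c2 : cmd)
| CWhile (i t : nat) (c : cmd).

Fixpoint lab (c : cmd) : finType :=
  match c with
  | CInc _ | CZero _ => unit
  | CSeq c1 c2 => (lab c1 + lab c2)%type
  | CIf _ _ c1 c2 => option (lab c1 + lab c2)%type
  | CWhile _ _ c => option (lab c)
  end.

Fixpoint entry (c : cmd) : lab c :=
  match c with
  | CInc _ | CZero _ => tt
  | CSeq c1 _ => inl (entry c1)
  | CIf _ _ _ _ | CWhile _ _ _ => None
  end.

(* The labels of c are placed among the labels K by emb, and ex is the label  *)
(* at which the execution continues after c.                                  *)
Fixpoint code (K : Type) (c : cmd) : (lab c -> K) -> K -> lab c -> instr K :=
  match c return (lab c -> K) -> K -> lab c -> instr K with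
  | CInc i => fun _ ex _ => IInc i ex
  | CZero i => fun _ ex _ => IZero i ex
  | CSeq c1 c2 => fun emb ex l =>
      match l with
      | inl l1 => code (emb \o inl) (emb (inr (entry c2))) l1
      | inr l2 => code (emb \o inr) ex l2
      end
  | CIf i t c1 c2 => fun emb ex l =>
      match l with
      | None => ITest i t (emb (Some (inl (entry c1)))) (emb (Some (inr (entry c2))))
      | Some (inl l1) => code (emb \o Some \o inl) ex l1
      | Some (inr l2) => code (emb \o Some \o inr) ex l2
      end
  | CWhile i t c => fun emb ex l =>
      match l with
      | None => ITest i t (emb (Some (entry c))) ex
      | Some l => code (emb \o Some) (emb None) l
      end
  end.

Fixpoint cok (k : nat) (c : cmd) : bool :=
  match c with
  | CInc i | CZero i => i < k
  | CSeq c1 c2 => cok k c1 && cok k c2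
  | CIf i t c1 c2 => [&& i < k, t < k.+3, cok k c1 & cok k c2]
  | CWhile i t c => [&& i < k, t < k.+3 & cok k c]
  end.

Lemma cok_mono k k' c : k <= k' -> cok k c -> cok k' c.
Proof.
move=> kk; elim: c => [i|i|c1 IH1 c2 IH2|i t c1 IH1 c2 IH2|i t c IH] /=; lia.
Qed.

Lemma cok_ex c : exists k, cok k c.
Proof.
elim: c => [i|i|c1 [k1 IH1] c2 [k2 IH2]|i t c1 [k1 IH1] c2 [k2 IH2]|i t c [k IH]].
- by exists i.+1 => /=.
- by exists i.+1 => /=.
- exists (k1 + k2) => /=; rewrite (cok_mono _ IH1) ?leq_addr //=.
  by rewrite (cok_mono _ IH2) ?leq_addl.
- exists (k1 + k2 + i.+1 + t) => /=.
  by rewrite (cok_mono _ IH1) ?(cok_mono _ IH2) ?andbT; lia.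
exists (k + i.+1 + t) => /=.
by rewrite (cok_mono _ IH) ?andbT; lia.
Qed.

Section BigStep.
Variables (x y : real) (d : nat).

(** Big-step semantics that also forbids incrementing [d]; a derivation thus certifies that the
    compiled run is calm for [d]. *)
Inductive ev : cmd -> (nat -> nat) -> (nat -> nat) -> Prop :=
| ev_inc i s : i != d -> ev (CInc i) s (upd s i (s i).+1)
| ev_zero i s : ev (CZero i) s (upd s i 0)
| ev_seq c1 c2 s1 s2 s3 : ev c1 s1 s2 -> ev c2 s2 s3 -> ev (CSeq c1 c2) s1 s3
| ev_if i t c1 c2 s s' :
    ev (if bit x y s t (s i) then c1 else c2) s s' -> ev (CIf i t c1 c2) s s'
| ev_while_done i t c s : ~~ bit x y s t (s i) -> ev (CWhile i t c) s s
| ev_while_loop i t c s s' s'' : bit x y s t (s i) -> ev c s s' ->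
    ev (CWhile i t c) s' s'' -> ev (CWhile i t c) s s''.

(** Induction on the derivation, for all placements [emb] of the labels at once: a subprogram lives
    inside the code under a composed embedding and exits at the entry of what follows it. *)
Lemma ev_reach (L : finType) (l0 : L) k (prog : L -> instr L) fl c s s' :
  ev c s s' -> cok k c ->
  forall (emb : lab c -> L) ex, (forall l, prog (emb l) = code emb ex l) ->
  reach (l0 := l0) (k := k) (prog := prog) (fl := fl) d
    (conf l0 k prog fl x y (emb (entry c)) s) (conf l0 k prog fl x y ex s').
Proof.
elim=> {c s s'} [i s id|i s|c1 c2 s1 s2 s3 e1 IH1 e2 IH2|i t c1 c2 s s' e IH|
  i t c s nb|i t c s s' s'' b e IH e' IH'] ok emb ex h.
- by apply: inc_reach => //; exact: (h tt).
- by apply: zero_reach => //; exact: (h tt).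
- move: ok => /= /andP[ok1 ok2].
  have r1 := IH1 ok1 (emb \o inl) _ (fun l => h (inl l)).
  have r2 := IH2 ok2 (emb \o inr) _ (fun l => h (inr l)).
  exact: reach_trans r1 r2.
- move: ok => /= /and4P[ik tk ok1 ok2].
  have r0 := test_reach l0 fl x y d s ik tk (h None).
  apply: (reach_trans r0); move: e IH; case: ifP => _ e IH.
    exact: (IH ok1 (emb \o Some \o inl) _ (fun l => h (Some (inl l)))).
  exact: (IH ok2 (emb \o Some \o inr) _ (fun l => h (Some (inr l)))).
- move: ok => /= /and3P[ik tk ok1].
  have := test_reach l0 fl x y d s ik tk (h None).
  by rewrite (negbTE nb).
move: (ok) => /= /and3P[ik tk ok1].
have := test_reach l0 fl x y d s ik tk (h None); rewrite b => r0.
apply: (reach_trans r0).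
have r1 := IH ok1 (emb \o Some) _ (fun l => h (Some l)).
apply: (reach_trans r1).
exact: IH' ok emb ex h.
Qed.

End BigStep.

(** * Evaluation of bounded formulas *)

(** Tape [c.+3] belongs to the register [c], so the loop test compares the counter [k] with [c]. *)
Definition CFor (k c : nat) (body : cmd) : cmd :=
  CSeq (CZero k) (CWhile k c.+3 (CSeq body (CInc k))).

Definition agree (r : nat) (s s' : nat -> nat) : Prop := forall i, i < r -> s' i = s i.

Fixpoint tbound (V : nat) (t : term) : bool :=
  match t with
  | TVar v => v < V
  | TZero | TOne => true
  | TAdd s t | TMul s t => tbound V s && tbound V t
  end.

Lemma teval_ext V t s s' : tbound V t -> agree V s s' -> teval s' t = teval s t.
Proof.
move=> b a; elim: t b => [v|||t1 IH1 t2 IH2|t1 IH1 t2 IH2] //=.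
- exact: a.
- by case/andP=> b1 b2; rewrite IH1 ?IH2.
- by case/andP=> b1 b2; rewrite IH1 ?IH2.
Qed.

Lemma tbound_mono V V' t : V <= V' -> tbound V t -> tbound V' t.
Proof.
move=> VV; elim: t => //= [v h|t1 IH1 t2 IH2 /andP[/IH1-> /IH2->]//|
  t1 IH1 t2 IH2 /andP[/IH1-> /IH2->]//]; exact: leq_trans VV.
Qed.

(** The counter [r] itself ends with the value of [v]; clearing [z] stands in for an empty body. *)
Definition CCopy (v r z : nat) : cmd := CFor r v (CZero z).

Fixpoint cterm (t : term) (r : nat) : cmd :=
  match t with
  | TVar v => CCopy v r r.+1
  | TZero => CZero r
  | TOne => CSeq (CZero r) (CInc r)
  | TAdd s t => CSeq (cterm s r) (CSeq (cterm t r.+1) (CFor r.+2 r.+1 (CInc r)))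
  | TMul s t =>
      CSeq (cterm s r.+1) (CSeq (cterm t r.+2) (CSeq (CZero r)
        (CFor r.+3 r.+1 (CFor r.+4 r.+2 (CInc r)))))
  end.

(* [BAll v u p] bounds the variable v by the value of the variable u.         *)
Inductive bf :=
| BEq (s t : term)
| BLt (s t : term)
| BIn (t : term) (X : bool)
| BNot (p : bf)
| BAnd (p q : bf)
| BAll (v u : nat) (p : bf).

Fixpoint bbound (V : nat) (p : bf) : bool :=
  match p with
  | BEq s t | BLt s t => tbound V s && tbound V t
  | BIn t _ => tbound V t
  | BNot p => bbound V p
  | BAnd p q => bbound V p && bbound V q
  | BAll v u p => [&& v < V, u < V, u != v & bbound V p]
  end.

(** The result in [r] is 0 or 1. A quantifier uses its own variable as loop counter: the old value
    is saved in [r.+1] and restored at the end, and [r] starts at 1 and is cleared by a failing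
    instance. Clearing a register that is already 0 means doing nothing. *)
Fixpoint cform (p : bf) (r : nat) : cmd :=
  match p with
  | BEq s t =>
      CSeq (cterm s r.+1) (CSeq (cterm t r.+2) (CSeq (CZero r)
        (CIf r.+1 r.+2.+3 (CZero r)
          (CIf r.+2 r.+1.+3 (CZero r) (CInc r)))))
  | BLt s t =>
      CSeq (cterm s r.+1) (CSeq (cterm t r.+2) (CSeq (CZero r)
        (CIf r.+1 r.+2.+3 (CInc r) (CZero r))))
  | BIn t X =>
      CSeq (cterm t r.+1) (CSeq (CZero r) (CIf r.+1 X (CInc r) (CZero r)))
  | BNot p =>
      CSeq (cform p r.+1) (CSeq (CZero r) (CIf r r.+1.+3 (CZero r) (CInc r)))
  | BAnd p q =>
      CSeq (cform p r.+1) (CSeq (cform q r.+2) (CSeq (CZero r)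
        (CIf r r.+1.+3 (CIf r r.+2.+3 (CInc r) (CZero r)) (CZero r))))
  | BAll v u p =>
      CSeq (CCopy v r.+1 r) (CSeq (CZero r) (CSeq (CInc r)
        (CSeq (CFor v u (CSeq (cform p r.+2) (CSeq (CZero r.+3)
          (CIf r.+3 r.+2.+3 (CZero r.+3) (CZero r)))))
        (CCopy r.+1 v r.+2))))
  end.

Ltac supd := repeat first [rewrite upd_same | rewrite upd_diff; [|by lia]].

Section Eval.
Variables (x y : real) (d : nat).

Local Notation ev := (ev x y d).

Fixpoint beval (e : nat -> nat) (p : bf) : bool :=
  match p with
  | BEq s t => teval e s == teval e t
  | BLt s t => teval e s < teval e t
  | BIn t X => if X then y (teval e t) else x (teval e t)
  | BNot p => ~~ beval e p
  | BAnd p q => beval e p && beval e q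
  | BAll v u p => all (fun j => beval (upd e v j) p) (iota 0 (e u))
  end.

Lemma ev_for k c n body (I : nat -> (nat -> nat) -> Prop) s :
  k != d -> I 0 (upd s k 0) ->
  (forall j s, I j s -> s k = j /\ s c = n) ->
  (forall j s, j < n -> I j s ->
    exists2 s', ev body s s' & I j.+1 (upd s' k (s' k).+1)) ->
  exists2 s', ev (CFor k c body) s s' & I n s'.
Proof.
move=> kd I0 IE IS.
suff loop m j s0 : j + m = n -> I j s0 ->
    exists2 s', ev (CWhile k c.+3 (CSeq body (CInc k))) s0 s' & I n s'.
  have [s' e h] := loop n 0 _ erefl I0; exists s' => //.
  by apply: ev_seq e; exact: ev_zero.
elim: m j s0 => [|m IH] j s0 jm Ij; have [ek ec] := IE _ _ Ij.
  move: jm; rewrite addn0 => jn; exists s0; last by rewrite -jn.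
  by apply: ev_while_done; rewrite /= ek ec jn ltnn.
have [s1 e1 I1] := IS j s0 ltac:(lia) Ij.
have [|s2 e2 I2] := IH _ _ _ I1; first by lia.
exists s2 => //; apply: ev_while_loop e2; first by rewrite /= ek ec; lia.
by apply: ev_seq e1 _; exact: ev_inc.
Qed.

Lemma ccopy_ok v r z s : r != d -> v != r -> z != v -> z != r ->
  exists2 s', ev (CCopy v r z) s s' &
    s' r = s v /\ (forall i, i != r -> i != z -> s' i = s i).
Proof.
move=> rd vr zv zr.
have [|||s' e [h1 h2 h3]] := @ev_for r v (s v) (CZero z)
    (fun j s' => [/\ s' r = j, s' v = s v &
       forall i, i != r -> i != z -> s' i = s i]) s rd.
- by split=> [||i ir _]; rewrite ?upd_same ?upd_diff.
- by move=> j s0 [].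
- move=> j s0 _ [jr ev a]; exists (upd s0 z 0); first exact: ev_zero.
  split=> [||i ir iz]; rewrite ?upd_same ?(upd_diff _ _ vr) ?(upd_diff _ _ ir).
  + by rewrite upd_diff ?jr // eq_sym.
  + by rewrite upd_diff // eq_sym.
  + by rewrite upd_diff // a.
by exists s'.
Qed.

Lemma cterm_ok t r s : tbound r t -> d < r ->
  exists2 s', ev (cterm t r) s s' & s' r = teval s t /\ agree r s s'.
Proof.
elim: t r s => [v|||t1 IH1 t2 IH2|t1 IH1 t2 IH2] r s /= b dr.
- have [||||s' e [h1 h2]] := @ccopy_ok v r r.+1 s; try lia.
  by exists s' => //; split=> // i ir; apply: h2; lia.
- exists (upd s r 0); first exact: ev_zero.
  by split=> [|i ir]; supd.
- exists (upd (upd s r 0) r 1).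
    apply: ev_seq; first exact: ev_zero.
    by rewrite -[in X in upd _ r X.+1](upd_same s r 0); apply: ev_inc; lia.
  by split=> [|i ir]; supd.
- case/andP: b => b1 b2.
  have [s1 e1 [h1 a1]] := IH1 r s b1 dr.
  have [|s2 e2 [h2 a2]] := IH2 r.+1 s1 (tbound_mono (leqnSn r) b2); first lia.
  have [||||s' e [h3 h4 h5 h6]] := @ev_for r.+2 r.+1 (s2 r.+1) (CInc r)
    (fun j s' => [/\ s' r.+2 = j, s' r.+1 = s2 r.+1, s' r = s2 r + j &
       agree r s2 s']) s2.
  + lia.
  + by split=> [|||i ir]; supd; rewrite ?addn0.
  + by move=> j s0 [].
  + move=> j s0 _ [g1 g2 g3 g4]; exists (upd s0 r (s0 r).+1).
      by apply: ev_inc; lia.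
    by split=> [|||i ir]; supd; rewrite ?g1 ?g2 ?g3 ?addnS ?g4.
  exists s'; first by apply: ev_seq e1 _; apply: ev_seq e2 e.
  split=> [|i ir]; last by rewrite h6 // a2 ?a1 //; lia.
  rewrite h5 h2 a2 ?h1 //; congr (_ + _); exact: teval_ext b2 a1.
case/andP: b => b1 b2.
have [|s1 e1 [h1 a1]] := IH1 r.+1 s (tbound_mono (leqnSn r) b1); first lia.
have [|s2 e2 [h2 a2]] := IH2 r.+2 s1 (tbound_mono (leqW (leqnSn r)) b2); first lia.
set s3 := upd s2 r 0.
have [||||s' e [h3 h4 h5 h6 h7]] := @ev_for r.+3 r.+1 (s2 r.+1)
  (CFor r.+4 r.+2 (CInc r))
  (fun j s' => [/\ s' r.+3 = j, s' r.+1 = s2 r.+1, s' r.+2 = s2 r.+2,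
     s' r = j * s2 r.+2 & agree r s2 s']) s3.
- lia.
- by rewrite /s3; split=> [||||i ir]; supd.
- by move=> j s0 [].
- move=> j s0 _ [g1 g2 g3 g4 g5].
  have [||||s4 e4 [k1 k2 k3 [k4 k5] k6]] := @ev_for r.+4 r.+2 (s2 r.+2) (CInc r)
    (fun j' s' => [/\ s' r.+4 = j', s' r.+2 = s2 r.+2, s' r = s0 r + j',
       s' r.+3 = s0 r.+3 /\ s' r.+1 = s2 r.+1 & agree r s2 s']) s0.
  + lia.
  + by split; [| | |split|move=> i ir; rewrite -(g5 _ ir)]; supd; rewrite ?addn0 ?g2 ?g3.
  + by move=> j' s5 [].
  + move=> j' s5 _ [m1 m2 m3 [m4 m5] m6]; exists (upd s5 r (s5 r).+1).
      by apply: ev_inc; lia.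
    by split; [| | |split|move=> i ir]; supd; rewrite ?m1 ?m2 ?m3 ?m4 ?m5 ?m6 ?addnS.
  exists s4 => //.
  by split=> [||||i ir]; supd; rewrite ?k4 ?k5 ?k2 ?k3 ?k6 ?g1 ?g4 // mulSn addnC.
exists s'.
  by apply: ev_seq e1 _; apply: ev_seq e2 _; apply: ev_seq e; exact: ev_zero.
split=> [|i ir]; last by rewrite h7 // a2 ?a1 //; lia.
rewrite h6 h2 a2 ?h1 //; congr (_ * _).
exact: (teval_ext (tbound_mono (leqnSn r) b2) a1).
Qed.

Lemma beval_ext V p s s' : bbound V p -> agree V s s' -> beval s' p = beval s p.
Proof.
elim: p s s' => [t1 t2|t1 t2|t X|p IH|p IHp q IHq|v u p IH] s s' /=.
- by case/andP=> b1 b2 a; rewrite (teval_ext b1 a) (teval_ext b2 a).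
- by case/andP=> b1 b2 a; rewrite (teval_ext b1 a) (teval_ext b2 a).
- by move=> b a; rewrite (teval_ext b a).
- by move=> b a; rewrite (IH _ _ b a).
- by case/andP=> b1 b2 a; rewrite (IHp _ _ b1 a) (IHq _ _ b2 a).
case/and4P=> vV uV _ b a; rewrite (a _ uV); apply: eq_all => j.
by apply: (IH _ _ b) => i iV; rewrite /upd; case: eqP => // _; exact: a.
Qed.

Lemma ev_one r s : r != d -> ev (CInc r) (upd s r 0) (upd (upd s r 0) r 1).
Proof. by move=> rd; have := ev_inc x y (upd s r 0) rd; rewrite upd_same. Qed.

Lemma cform_ok V p r s : bbound V p -> V <= d -> d < r ->
  exists2 s', ev (cform p r) s s' & s' r = beval s p :> nat /\ agree r s s'.
Proof.
move=> + Vd; elim: p r s => [t1 t2|t1 t2|t X|p IH|p IHp q IHq|v u p IH] r s /= b dr;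
  have rd : r != d by lia.
- case/andP: b => b1 b2; have Vr : V <= r.+1 by lia.
  have [|s1 e1 [h1 a1]] := @cterm_ok t1 r.+1 s (tbound_mono Vr b1); first by lia.
  have [|s2 e2 [h2 a2]] := @cterm_ok t2 r.+2 s1 (tbound_mono (leqW Vr) b2);
    first by lia.
  have E1 : s2 r.+1 = teval s t1 by rewrite a2.
  have E2 : s2 r.+2 = teval s t2.
    by rewrite h2; apply: teval_ext b2 _ => i iV; apply: a1; lia.
  exists (upd (upd s2 r 0) r (teval s t1 == teval s t2)).
    apply: (ev_seq e1); apply: (ev_seq e2); apply: ev_seq; first exact: ev_zero.
    apply: ev_if; rewrite /=; supd; rewrite E1 E2.
    case: ltngtP => c; first exact: ev_zero.
      by apply: ev_if; rewrite /=; supd; rewrite E1 E2 c; exact: ev_zero.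
    by apply: ev_if; rewrite /=; supd; rewrite E1 E2 c ltnn; exact: ev_one.
  split=> [|i ir]; supd => //; rewrite a2 ?a1 //; lia.
- case/andP: b => b1 b2; have Vr : V <= r.+1 by lia.
  have [|s1 e1 [h1 a1]] := @cterm_ok t1 r.+1 s (tbound_mono Vr b1); first by lia.
  have [|s2 e2 [h2 a2]] := @cterm_ok t2 r.+2 s1 (tbound_mono (leqW Vr) b2);
    first by lia.
  have E1 : s2 r.+1 = teval s t1 by rewrite a2.
  have E2 : s2 r.+2 = teval s t2.
    by rewrite h2; apply: teval_ext b2 _ => i iV; apply: a1; lia.
  exists (upd (upd s2 r 0) r (teval s t1 < teval s t2)).
    apply: (ev_seq e1); apply: (ev_seq e2); apply: ev_seq; first exact: ev_zero.
    apply: ev_if; rewrite /=; supd; rewrite E1 E2.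
    by case: ifP => c; [exact: ev_one|exact: ev_zero].
  split=> [|i ir]; supd => //; rewrite a2 ?a1 //; lia.
- have Vr : V <= r.+1 by lia.
  have [|s1 e1 [h1 a1]] := @cterm_ok t r.+1 s (tbound_mono Vr b); first by lia.
  exists (upd (upd s1 r 0) r (if X then y (teval s t) else x (teval s t))).
    apply: (ev_seq e1); apply: ev_seq; first exact: ev_zero.
    apply: ev_if; have -> : bit x y (upd s1 r 0) X (upd s1 r 0 r.+1) =
      (if X then y (teval s t) else x (teval s t)) by supd; rewrite h1; case: (X).
    by case: ifP => c; [exact: ev_one|exact: ev_zero].
  split=> [|i ir]; supd => //; rewrite a1 //; lia.
- have [|s1 e1 [h1 a1]] := IH r.+1 s b; first by lia.
  exists (upd (upd s1 r 0) r (~~ beval s p)).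
    apply: (ev_seq e1); apply: ev_seq; first exact: ev_zero.
    apply: ev_if; rewrite /=; supd; rewrite h1 lt0b.
    by case: ifP => c; [exact: ev_zero|exact: ev_one].
  split=> [|i ir]; supd => //; rewrite a1 //; lia.
- case/andP: b => b1 b2.
  have [|s1 e1 [h1 a1]] := IHp r.+1 s b1; first by lia.
  have [|s2 e2 [h2 a2]] := IHq r.+2 s1 b2; first by lia.
  have E2 : beval s1 q = beval s q.
    by apply: beval_ext b2 _ => i iV; apply: a1; lia.
  exists (upd (upd s2 r 0) r (beval s p && beval s q)).
    apply: (ev_seq e1); apply: (ev_seq e2); apply: ev_seq; first exact: ev_zero.
    apply: ev_if; rewrite /=; supd; rewrite a2 // h1 lt0b.
    case: ifP => c; last exact: ev_zero.
    apply: ev_if; rewrite /=; supd; rewrite h2 E2 lt0b.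
    by case: ifP => c'; [exact: ev_one|exact: ev_zero].
  split=> [|i ir]; supd => //; rewrite a2 ?a1 //; lia.
case/and4P: b => vV uV uv b.
have [||||s1 e1 [h1 g1]] := @ccopy_ok v r.+1 r s; try lia.
pose s3 := upd (upd s1 r 0) r 1.
pose body := CSeq (cform p r.+2) (CSeq (CZero r.+3)
          (CIf r.+3 r.+2.+3 (CZero r.+3) (CZero r))).
have [||||s4 e4 [k1 k2 k3 k4 k5]] := @ev_for v u (s u) body
  (fun j s' => [/\ s' v = j, s' u = s u, s' r.+1 = s v,
     s' r = all (fun j => beval (upd s v j) p) (iota 0 j) :> nat &
     forall i, i < r -> i != v -> s' i = s i]) s3.
- lia.
- by split=> [||||i ir iv]; rewrite /s3; supd; rewrite // g1 //; lia.
- by move=> j s0 [].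
- move=> j s0 _ [g2 g3 g4 g5 g6].
  have [|s5 e5 [h5 a5]] := IH r.+2 s0 b; first by lia.
  have E5 : beval s0 p = beval (upd s v j) p.
    apply: beval_ext b _ => i iV; rewrite /upd; case: eqP => [->//|/eqP iv].
    by apply: g6 => //; lia.
  exists (if beval s0 p then upd (upd s5 r.+3 0) r.+3 0 else upd (upd s5 r.+3 0) r 0).
    apply: (ev_seq e5); apply: ev_seq; first exact: ev_zero.
    apply: ev_if; rewrite /=; supd; rewrite h5 lt0b.
    by case: ifP => c; exact: ev_zero.
  rewrite -(addn1 j) iotaD all_cat /= andbT add0n -E5.
  split=> [||||i ir iv]; case: (beval s0 p); supd; rewrite ?andbT ?andbF //;
    rewrite a5 ?g2 ?addn1 //; try lia; exact: g6.
have [||||s6 e6 [h6 g6]] := @ccopy_ok r.+1 v r.+2 s4; try lia.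
exists s6.
  apply: (ev_seq e1); apply: ev_seq; first exact: ev_zero.
  apply: ev_seq; first exact: ev_one.
  exact: (ev_seq e4 e6).
split=> [|i ir]; first by rewrite g6 //; lia.
by case: (i =P v) => [->|/eqP iv]; [rewrite h6|rewrite g6 ?k5 //; lia].
Qed.

End Eval.

(** * Limit acceptance *)

Section StageOmega.
Variables (T : ittm) (x y : real).
Local Notation run n := (iter n (@step T) (init_config T x y)).
Hypothesis run_on : forall n, ~~ halted (run n).

Lemma stage_finite n : stage x y (onat n) (run n).
Proof.
elim: n => [|n IH]; first by apply: stage_zero; exact: oeq_refl.
by apply: stage_succ (oeq_refl _) IH _.
Qed.

(** The ordinals below omega are the [onat n], so cofinally often becomes infinitely often along the
    finite run. *)
Lemma stage_omega : exists c : config T, [/\ stage x y omega c,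
  c_state c = q_limit T, c_head c = 0 &
  forall i p, c_tape c i p <-> forall N, exists2 n, N <= n & c_tape (run n) i p].
Proof.
have /choice [h hP] : forall b, exists c : config T, forall n, oeq b (onat n) -> c = run n.
  move=> b; have [[n bn]|nb] := pselect (exists n, oeq b (onat n)).
    exists (run n) => m bm; congr iter; apply/eqP; rewrite eqn_leq.
    have [h1 h2] := oeq_trans (oeq_sym bn) bm.
    by apply/andP; split; apply/ole_onat.
  by exists (init_config T x y) => n bn; case: nb; exists n.
exists (limit_config omega h); split=> //.
  apply: stage_limit; first exact: olimit_omega.
  move=> b /olt_omegaP [n bn]; rewrite (hP _ _ bn).
  by apply: stage_eq (stage_finite n); exact: oeq_sym.
move=> i p /=; split=> [/asboolP H N|H].
  have [|g [Ng /olt_omegaP [n gn]]] := H (onat N).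
    by apply/olt_omegaP; exists N; exact: oeq_refl.
  rewrite (hP _ _ gn) => hn; exists n => //.
  by apply/ole_onat; apply: ole_trans Ng (proj1 gn).
apply/asboolP => b /olt_omegaP [N bN]; have [n Nn hn] := H N.
exists (onat n); split; last by rewrite (hP _ _ (oeq_refl _)).
  by apply: ole_trans (proj1 bN) _; apply/ole_onat.
by apply/olt_omegaP; exists n; exact: oeq_refl.
Qed.

End StageOmega.

(** * The endless search and its flag *)

Section Loop.
Variables (V S M : nat) (Th : bf).
Hypotheses (SV : S < V) (MV : M < V) (SM : S != M) (ThV : bbound V Th).

(* The register V is the flag. It is cleared at the start of each round, so   *)
(* that at the start of a round it tells whether the previous one succeeded.  *)
Definition loop_body : cmd :=
  CSeq (CZero V) (CSeq (cform Th V.+2) (CSeq (CZero V.+3)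
    (CSeq (CIf V.+3 V.+2.+3 (CSeq (CInc V) (CInc S)) (CZero V.+3)) (CInc M)))).

Section Run.
Variables (x y : real).

Lemma loop_body_ok s : exists2 s',
  ev x y (if beval x y s Th then V.+1 else V) loop_body s s' &
  [/\ s' V = beval x y s Th :> nat, s' S = s S + beval x y s Th, s' M = (s M).+1 &
     forall i, i < V -> i != S -> i != M -> s' i = s i].
Proof.
set d := if _ then _ else _.
have dV : V <= d < V.+2 by rewrite /d; case: ifP; lia.
have [||s1 e1 [h1 a1]] := @cform_ok x y d V Th V.+2 (upd s V 0) ThV; try lia.
have E : beval x y (upd s V 0) Th = beval x y s Th.
  by apply: beval_ext ThV _ => i iV; supd.
rewrite E in h1.
set s2 := upd s1 V.+3 0.
have i0 i : i < V -> s1 i = s i by move=> iV; rewrite a1; supd; lia.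
have iV : s1 V = 0 by rewrite a1; supd; lia.
have dE : d = if beval x y s Th then V.+1 else V by [].
case b: (beval x y s Th); rewrite b in h1 dE.
  set s3 := upd s2 V (s2 V).+1; set s4 := upd s3 S (s3 S).+1.
  exists (upd s4 M (s4 M).+1).
    apply: ev_seq; first exact: ev_zero.
    apply: (ev_seq e1); apply: ev_seq; first exact: ev_zero.
    apply: (ev_seq (s2 := s4)); last by apply: ev_inc; lia.
    apply: ev_if; rewrite /= -/s2.
    have -> : s2 V.+3 < s2 V.+2 by rewrite /s2; supd; rewrite h1.
    by apply: (ev_seq (s2 := s3)); apply: ev_inc; lia.
  by split=> [|||i iV' iS iM]; rewrite /s4 /s3 /s2; supd; rewrite ?iV ?i0 // addn1.
exists (upd (upd s2 V.+3 0) M (s M).+1).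
  apply: ev_seq; first exact: ev_zero.
  apply: (ev_seq e1); apply: ev_seq; first exact: ev_zero.
  apply: (ev_seq (s2 := upd s2 V.+3 0)).
    apply: ev_if; rewrite /= -/s2.
    have -> : (s2 V.+3 < s2 V.+2) = false by rewrite /s2; supd; rewrite h1.
    exact: ev_zero.
  have <- : upd s2 V.+3 0 M = s M by rewrite /s2; supd; rewrite i0.
  by apply: ev_inc; lia.
by split=> [|||i iV' iS iM]; rewrite /s2; supd; rewrite ?iV ?i0 // addn0.
Qed.

Definition loop_env (s m : nat) : nat -> nat := upd (upd (fun _ => 0) S s) M m.

Fixpoint loop_count (n : nat) : nat :=
  if n is m.+1 then loop_count m + beval x y (loop_env (loop_count m) m) Th else 0.

Definition success (n : nat) : bool := beval x y (loop_env (loop_count n) n) Th.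

Variable k : nat.
Hypothesis ok : cok k loop_body.

Definition loop_machine : ittm :=
  @cmachine (lab loop_body) (entry loop_body) k
    (code id (entry loop_body)) V.

Local Notation cf s :=
  (conf (entry loop_body) k (code id (entry loop_body)) V x y (entry loop_body) s).
Local Notation calm := (@calm (lab loop_body) (entry loop_body) k
    (code id (entry loop_body)) V).
Local Notation run n := (iter n (@step loop_machine) (init_config loop_machine x y)).

Lemma run1 : run 1 = cf (fun _ => 0).
Proof.
rewrite /= /conf.
have := @step_set _ (entry loop_body) k (code id (entry loop_body)) V
  (inl (true, true)) 0 (nth blank [:: x; y]) (qsweep (entry loop_body)) MoveL 2 true erefl.
by move=> /= ->; apply: mkc_ext => -[|[|[|i]]] n _ //=; rewrite ?andbF ?andbT ?nth_nil //;
  case: (n).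
Qed.

Definition at_loop (n t : nat) (s : nat -> nat) : Prop :=
  [/\ run t = cf s, (forall i, i < V -> s i = loop_env (loop_count n) n i) & n < t].

Lemma at_loop_next n t s : at_loop n t s ->
  exists t' s', [/\ at_loop n.+1 (t + t') s', s' V = success n, 0 < t' &
    forall j, j < t' -> calm (if success n then V.+1 else V) (run (t + j))].
Proof.
move=> [et es nt].
have sE : beval x y s Th = success n.
  by apply: beval_ext ThV _ => i iV; rewrite es.
have [s' e [h1 h2 h3 h4]] := loop_body_ok s; rewrite sE in e h1 h2.
have [m [m0 em cm]] := @ev_reach x y _ (lab loop_body) (entry loop_body) k
  (code id (entry loop_body)) V _ _ _ e ok id (entry loop_body) (fun=> erefl).
exists m, s'; split=> //; last first.
  by move=> j jm; rewrite addnC iterD et; exact: cm.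
split; [by rewrite addnC iterD et em| |lia].
move=> i iV; rewrite /loop_env /upd /=.
case: (i =P M) => [->|/eqP iM]; first by rewrite h3 es // /loop_env upd_same.
case: (i =P S) => [->|/eqP iS].
  by rewrite h2 es // /loop_env; supd.
by rewrite h4 // es // /loop_env; supd.
Qed.

Lemma at_loop0 : at_loop 0 1 (fun _ => 0).
Proof.
by split=> // [|i iV]; [exact: run1|rewrite /loop_env /upd; case: ifP => // _; case: ifP].
Qed.

Lemma at_loop_ex n : exists t s, [/\ at_loop n.+1 t s, s V = success n &
  forall j, j < t -> ~~ halted (run j)].
Proof.
have nh d c : calm d c -> ~~ halted c.
  by rewrite /calm /halted; case: (c_state c) => [[[] []]|[l|l]].
have step_ n' t s : at_loop n' t s -> (forall j, j < t -> ~~ halted (run j)) ->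
    exists t s, [/\ at_loop n'.+1 t s, s V = success n' &
    forall j, j < t -> ~~ halted (run j)].
  move=> h hj; have [t' [s' [h1 h2 _ h4]]] := at_loop_next h.
  exists (t + t'), s'; split=> // j jt; case: (ltnP j t) => [/hj//|tj].
  by rewrite -(subnKC tj); apply: nh; apply: h4; lia.
elim: n => [|n [t [s [h _ hj]]]]; last exact: step_ h hj.
apply: step_ at_loop0 _ => -[] //.
Qed.

Lemma loop_run_on n : ~~ halted (run n).
Proof.
by have [t [s [[_ _ nt] _ h]]] := at_loop_ex n; apply: h; exact: ltnW.
Qed.

Lemma flag_tape : V.+3 < ntapes loop_machine.
Proof. by move: ok; rewrite /ntapes /loop_body /= => /and3P[]. Qed.

Definition flag (c : config loop_machine) : bool := c_tape c (Ordinal flag_tape) 0.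

Lemma calm_flag c : calm V c -> ~~ flag c -> ~~ flag (step c).
Proof. exact: calm_tape. Qed.

(** A success shows as a raised flag when the next round starts. If all rounds from [N] on fail, the
    flag is down at the start of round [N.+1], and calm steps never raise it again. *)
Lemma flag_limit : (forall N, exists2 n, N <= n & flag (run n)) <->
  (forall N, exists2 n, N <= n & success n).
Proof.
split=> H N; last first.
  have [n Nn sn] := H N; have [t [s [[et _ nt] sV _]]] := at_loop_ex n.
  exists t; first by lia.
  by rewrite et /flag /= sV sn.
apply: contrapT => nN.
have fn n : N <= n -> success n = false.
  by move=> Nn; apply/negP => sn; apply: nN; exists n.
have [t [s [h sV _]]] := at_loop_ex N; rewrite fn // in sV.
(* Each round takes at least one step, so [m] failing rounds give at least [m] calm steps. *)
have cal m : exists t' s', [/\ at_loop (N.+1 + m) (t + t') s', m <= t' &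
    forall j, j < t' -> calm V (run (t + j))].
  elim: m => [|m [t' [s' [h1 h2 h3]]]]; first by exists 0, s; rewrite !addn0.
  have [t2 [s2 [g1 _ g3 g4]]] := at_loop_next h1.
  exists (t' + t2), s2; split; [by rewrite addnS addnA|lia|].
  move=> j jt; case: (ltnP j t') => [/h3//|tj].
  rewrite -(subnKC tj) addnA; have := g4 (j - t').
  by rewrite fn; [apply; lia|lia].
have nf j : ~~ flag (run (t + j)).
  elim: j => [|j IH]; first by rewrite addn0; case: h => -> _ _; rewrite /flag /= sV.
  rewrite addnS iterS; apply: calm_flag IH.
  by have [t' [s' [_ h2 h3]]] := cal j.+1; apply: h3; exact: h2.
have [n tn] := H t; apply/negP; have := nf (n - t); by rewrite subnKC.
Qed.

(** No finite stage halts, so the limit state occurs at stage omega, and the step from it turns the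
    limsup of the flag into the verdict. As halting stages are unique, the verdict there decides
    acceptance. *)
Lemma loop_accepts :
  halts_in loop_machine x y omega /\
  (accepts loop_machine x y <-> forall N, exists2 n, N <= n & success n).
Proof.
have [c [sc cq ch ct]] := stage_omega loop_run_on.
have ss : stage x y (osucc omega) (step c).
  by apply: stage_succ (oeq_refl _) sc _; rewrite /halted cq.
have sq : c_state (step c) = (inl (false, flag c) : ittm_state loop_machine).
  rewrite /step cq /= /flag; congr (inl (false, _)).
  have := tnth_mktuple (fun i => c_tape c i (c_head c)) (Ordinal flag_tape).
  by rewrite (tnth_nth false) ch.
have hs : halted (step c) by rewrite /halted sq; case: (flag c).
split; first by exists (step c).
rewrite -flag_limit -ct; split=> [[a [c' [sa qa]]]|fc].
  have [|_ ec] := halted_stage_uniq sa ss _ hs; first by rewrite /halted qa inE eqxx.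
  by move: qa; rewrite ec sq => -[].
by exists (osucc omega), (step c); split=> //; rewrite sq /flag fc.
Qed.

End Run.
End Loop.

(** * Coherent truth tables *)

(** A polynomial, so that pairing is a term of the language. The value lies between the squares of a
    + b and a + b + 1, hence determines a + b and then a. *)
Definition cpair (a b : nat) : nat := (a + b) * (a + b) + a.

Lemma cpair_inj a b a' b' : cpair a b = cpair a' b' -> a = a' /\ b = b'.
Proof.
rewrite /cpair => e; suff : a + b = a' + b' by nia.
by case: (ltngtP (a + b) (a' + b')); nia.
Qed.

Definition TPair (s t : term) : term := TAdd (TMul (TAdd s t) (TAdd s t)) s.

Fixpoint tnum (n : nat) : term := if n is m.+1 then TAdd (tnum m) TOne else TZero.

Lemma teval_num e n : teval e (tnum n) = n.
Proof. by elim: n => //= n ->; rewrite addn1. Qed.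

Definition ccode (l : seq nat) : nat := foldr cpair 0 l.

Lemma ccode_inj l l' : size l = size l' -> ccode l = ccode l' -> l = l'.
Proof.
elim: l l' => [|a l IH] [|a' l'] //= [sz] /cpair_inj[-> e].
by rewrite (IH l').
Qed.

Fixpoint term_code (t : term) : nat :=
  match t with
  | TVar v => cpair 0 v
  | TZero => cpair 1 0
  | TOne => cpair 2 0
  | TAdd s t => cpair 3 (cpair (term_code s) (term_code t))
  | TMul s t => cpair 4 (cpair (term_code s) (term_code t))
  end.

Lemma term_code_inj : injective term_code.
Proof.
elim=> [v|||s IHs t IHt|s IHs t IHt] [v'|||s' t'|s' t'] /cpair_inj[//] _.
- by move=> ->.
- by move=> /cpair_inj[/IHs-> /IHt->].
- by move=> /cpair_inj[/IHs-> /IHt->].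
Qed.

Fixpoint form_code (p : arith) : nat :=
  match p with
  | FEq s t => cpair 0 (cpair (term_code s) (term_code t))
  | FLt s t => cpair 1 (cpair (term_code s) (term_code t))
  | FIn t X => cpair 2 (cpair (term_code t) X)
  | FNot p => cpair 3 (form_code p)
  | FAnd p q => cpair 4 (cpair (form_code p) (form_code q))
  | FAll v p => cpair 5 (cpair v (form_code p))
  end.

Lemma form_code_inj : injective form_code.
Proof.
elim=> [s t|s t|t X|p IH|p IHp q IHq|v p IH] [s' t'|s' t'|t' X'|p'|p' q'|v' p']
  /cpair_inj[//] _.
- by move=> /cpair_inj[/term_code_inj-> /term_code_inj->].
- by move=> /cpair_inj[/term_code_inj-> /term_code_inj->].
- by move=> /cpair_inj[/term_code_inj-> ->].
- by move=> /IH->.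
- by move=> /cpair_inj[/IHp-> /IHq->].
- by move=> /cpair_inj[-> /IH->].
Qed.

Fixpoint fbound (K : nat) (p : arith) : bool :=
  match p with
  | FEq s t | FLt s t => tbound K s && tbound K t
  | FIn t _ => tbound K t
  | FNot p => fbound K p
  | FAnd p q => fbound K p && fbound K q
  | FAll v p => (v < K) && fbound K p
  end.

Lemma fbound_mono K K' p : K <= K' -> fbound K p -> fbound K' p.
Proof.
move=> KK; elim: p => [s t|s t|t X|p IH|p IHp q IHq|v p IH] //=.
- by case/andP=> /(tbound_mono KK)-> /(tbound_mono KK)->.
- by case/andP=> /(tbound_mono KK)-> /(tbound_mono KK)->.
- exact: tbound_mono.
- by case/andP=> /IHp-> /IHq->.
- by case/andP=> vK /IH->; rewrite (leq_trans vK).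
Qed.

Lemma tbound_ex t : exists K, tbound K t.
Proof.
elim: t => [v|||s [K1 h1] t [K2 h2]|s [K1 h1] t [K2 h2]];
  try (by exists 0); first (by exists v.+1 => /=);
  by exists (K1 + K2) => /=; rewrite (tbound_mono _ h1) ?(tbound_mono _ h2); lia.
Qed.

Lemma fbound_ex p : exists K, fbound K p.
Proof.
elim: p => [s t|s t|t X|p [K IH]|p [K1 h1] q [K2 h2]|v p [K IH]].
- have [K1 h1] := tbound_ex s; have [K2 h2] := tbound_ex t.
  by exists (K1 + K2) => /=; rewrite (tbound_mono _ h1) ?(tbound_mono _ h2); lia.
- have [K1 h1] := tbound_ex s; have [K2 h2] := tbound_ex t.
  by exists (K1 + K2) => /=; rewrite (tbound_mono _ h1) ?(tbound_mono _ h2); lia.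
- by have [K h] := tbound_ex t; exists K.
- by exists K.
- by exists (K1 + K2) => /=; rewrite (fbound_mono _ h1) ?(fbound_mono _ h2); lia.
- by exists (K + v.+1) => /=; rewrite (fbound_mono _ IH); lia.
Qed.

Section Matrix.
Variable K : nat.

Section Truth.
Variables (x y : real).

(* y codes the set [fun n => y (cpair 0 n)] and, for each formula q, the set   *)
(* of the assignments l of values to the variables below K that satisfy q.    *)
Definition holds (q : arith) (l : seq nat) : bool :=
  y (cpair (form_code q).+1 (ccode l)).

(** Local truth conditions for [q] and its subformulas. A universal formula marked true is tested at
    the instance [n]; one marked false must have a counterexample below [m]. Hence coherence reads:
    for all [l] and [n] there is [m]. *)
Fixpoint cond (l : seq nat) (n m : nat) (q : arith) : bool :=
  match q with
  | FEq s t => holds q l == (teval (nth 0 l) s == teval (nth 0 l) t)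
  | FLt s t => holds q l == (teval (nth 0 l) s < teval (nth 0 l) t)
  | FIn t 0 => holds q l == x (teval (nth 0 l) t)
  | FIn t 1 => holds q l == y (cpair 0 (teval (nth 0 l) t))
  | FIn t _ => ~~ holds q l
  | FNot p => (holds q l == ~~ holds p l) && cond l n m p
  | FAnd p1 p2 =>
      [&& holds q l == holds p1 l && holds p2 l, cond l n m p1 & cond l n m p2]
  | FAll v p =>
      [&& holds q l ==> holds p (set_nth 0 l v n),
          ~~ holds q l ==> ~~ all (fun j => holds p (set_nth 0 l v j)) (iota 0 m)
        & cond l n m p]
  end.

Lemma cond_mono l n m m' q : m <= m' -> cond l n m q -> cond l n m' q.
Proof.
move=> mm; elim: q => [s t|s t|t X|p IH|p1 IH1 p2 IH2|v p IH] //=.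
- by case/andP=> -> /IH.
- by case/and3P=> -> /IH1-> /IH2->.
case/and3P=> -> /implyP h /IH->; rewrite andbT /=; apply/implyP => /h.
by apply: contra; rewrite -(subnKC mm) iotaD all_cat => /andP[].
Qed.

Definition set_xy (Y : real) : nat -> real := nth blank [:: x; Y].

Lemma sat_update X l v n q :
  sat X [eta nth 0 l with v |-> n] q = sat X (nth 0 (set_nth 0 l v n)) q.
Proof.
by congr sat; apply/funext => i; rewrite nth_set_nth.
Qed.

Lemma size_update l v (n : nat) : size l = K -> v < K -> size (set_nth 0 l v n) = K.
Proof. by rewrite size_set_nth => -> /maxn_idPr. Qed.

(** The tests at all [l] and [n] amount to Tarski's truth conditions, so induction on [q] identifies
    the table with satisfaction for the set stored in row 0. *)
Lemma cond_sound q : fbound K q ->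
  (forall l n, size l = K -> exists m, cond l n m q) ->
  forall l, size l = K ->
    (holds q l <-> sat (set_xy (fun n => y (cpair 0 n))) (nth 0 l) q).
Proof.
elim: q => [s t|s t|t [|[|X]]|p IH|p1 IH1 p2 IH2|v p IH] /= b H l lK.
- by have [m /eqP->] := H l 0 lK; split=> /eqP.
- by have [m /eqP->] := H l 0 lK; split.
- by have [m /eqP->] := H l 0 lK.
- by have [m /eqP->] := H l 0 lK.
- by have [m /negbTE->] := H l 0 lK; rewrite /set_xy /= nth_nil.
- have [m /andP[/eqP-> _]] := H l 0 lK.
  rewrite -(IH b _ l lK); first by split=> /negP.
  by move=> l' n /(H l' n)[m' /andP[_ h]]; exists m'.
- have [m /and3P[/eqP-> _ _]] := H l 0 lK; case/andP: b => b1 b2.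
  rewrite -(IH1 b1 _ l lK) -?(IH2 b2 _ l lK); first by split=> /andP.
    by move=> l' n /(H l' n)[m' /and3P[_ _ h]]; exists m'.
  by move=> l' n /(H l' n)[m' /and3P[_ h _]]; exists m'.
case/andP: b => vK b.
have IHl n : holds p (set_nth 0 l v n) <->
    sat (set_xy (fun n => y (cpair 0 n))) [eta nth 0 l with v |-> n] p.
  rewrite sat_update; apply: IH => //; last exact: size_update.
  by move=> l' n' /(H l' n')[m' /and3P[_ _ h]]; exists m'.
split=> [h n|h].
  by have [m /and3P[/implyP/(_ h) hn _ _]] := H l n lK; apply/IHl.
apply: contrapT => /negP nh; have [m /and3P[_ /implyP/(_ nh)/allPn[j _ hj] _]] := H l 0 lK.
by move/negP: hj; apply; apply/IHl; exact: h.
Qed.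

End Truth.

(** The witness stores [Y] in row 0 and the actual truth values in the rows of the formulas. *)
Lemma cond_complete x Y : exists y, (forall n, y (cpair 0 n) = Y n) /\
  (forall q l, size l = K -> (holds y q l <-> sat (set_xy x Y) (nth 0 l) q)) /\
  (forall q l n, fbound K q -> size l = K -> exists m, cond x y l n m q).
Proof.
pose y z := `[< (exists2 n, z = cpair 0 n & Y n) \/
  (exists q l, [/\ size l = K, z = cpair (form_code q).+1 (ccode l) &
     sat (set_xy x Y) (nth 0 l) q]) >].
exists y.
have y0 n : y (cpair 0 n) = Y n.
  apply/asboolP/idP => [[[n' /cpair_inj[_ ->]//]|[q [l [_ /cpair_inj[]//]]]]|Yn].
  by left; exists n.
have yq q l : size l = K -> (holds y q l <-> sat (set_xy x Y) (nth 0 l) q).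
  move=> lK; split=> [/asboolP[[n /cpair_inj[]//]|]|h].
    move=> [q' [l' [lK' /cpair_inj[[/form_code_inj->]]]]].
    by move/ccode_inj => -> //; rewrite lK lK'.
  by apply/asboolP; right; exists q, l.
have yqB q l : size l = K -> holds y q l = `[< sat (set_xy x Y) (nth 0 l) q >].
  by move=> lK; apply/idP/asboolP => /yq; apply.
split=> //; split=> // q l n + lK.
elim: q => [s t|s t|t [|[|X]]|p IH|p1 IH1 p2 IH2|v p IH] b.
- by exists 0; rewrite /= yqB //; apply/eqP; apply/asboolP/eqP.
- by exists 0; rewrite /= yqB //; apply/eqP; apply/asboolP/idP.
- by exists 0; rewrite /= yqB //; apply/eqP; apply/asboolP/idP.
- by exists 0; rewrite /= yqB //; apply/eqP; rewrite y0; apply/asboolP/idP.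
- by exists 0; rewrite /= yqB //; apply/asboolP; rewrite /= /set_xy /= nth_nil.
- have [m h] := IH b; exists m; rewrite /= h andbT !yqB //.
  by apply/eqP; rewrite -asbool_neg.
- case/andP: b => /IH1[m1 h1] /IH2[m2 h2]; exists (m1 + m2).
  rewrite /= (cond_mono (leq_addr _ _) h1) (cond_mono (leq_addl _ _) h2) !andbT !yqB //.
  by rewrite /= asbool_and.
case/andP: b => vK b; have [m h] := IH b.
have E j : holds y p (set_nth 0 l v j) <-> sat (set_xy x Y) [eta nth 0 l with v |-> j] p.
  by rewrite sat_update yq // size_update.
case hq: (holds y (FAll v p) l).
  exists m; rewrite /= hq h !andbT /=; apply/E.
  by move/(yq _ _ lK): hq; exact.
have [j nj] : exists j, ~ holds y p (set_nth 0 l v j).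
  apply/not_existsP => H; move/negP: hq; apply; apply/yq => // j.
  by apply/E; apply: contrapT; exact: H.
(* The bound has to exceed the counterexample [j] and to suffice for the subformula. *)
exists (m + j.+1); rewrite /= hq /= (cond_mono (leq_addr _ _) h) andbT.
apply/allPn; exists j; last exact/negP.
by rewrite mem_iota; lia.
Qed.

(** * Coherence as a bounded formula *)

Definition vars_but (v : nat) (t : term) : seq term :=
  [seq if i == v then t else TVar i | i <- iota 0 K].
Definition vars : seq term := [seq TVar i | i <- iota 0 K].

Definition batom (q : arith) (ts : seq term) : bf :=
  BIn (TPair (tnum (form_code q).+1) (foldr TPair TZero ts)) true.

Definition bimp (p q : bf) : bf := BNot (BAnd p (BNot q)).
Definition biff (p q : bf) : bf := BAnd (bimp p q) (bimp q p).

(** Variables below [K] hold the assignment and [K] the tested instance; [K.+1] is the bound s on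
    all of these, [K.+2] the bound m, and [K.+3] runs through candidate counterexamples. *)
Fixpoint bcond (q : arith) : bf :=
  match q with
  | FEq s t => biff (batom q vars) (BEq s t)
  | FLt s t => biff (batom q vars) (BLt s t)
  | FIn t 0 => biff (batom q vars) (BIn t false)
  | FIn t 1 => biff (batom q vars) (BIn (TPair TZero t) true)
  | FIn t _ => BNot (batom q vars)
  | FNot p => BAnd (biff (batom q vars) (BNot (batom p vars))) (bcond p)
  | FAnd p1 p2 =>
      BAnd (biff (batom q vars) (BAnd (batom p1 vars) (batom p2 vars)))
        (BAnd (bcond p1) (bcond p2))
  | FAll v p =>
      BAnd (bimp (batom q vars) (batom p (vars_but v (TVar K))))
        (BAnd (bimp (BNot (batom q vars))
                 (BNot (BAll K.+3 K.+2 (batom p (vars_but v (TVar K.+3))))))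
           (bcond p))
  end.

(** The last conjunct asks for [p] under the zero assignment, the one used by [sat2]. *)
Definition bmatrix (p : arith) : bf :=
  BAnd (foldr (fun v => BAll v K.+1) (bcond p) (iota 0 K.+1))
    (batom p (nseq K TZero)).

Lemma beval_not x y e p : beval x y e (BNot p) = ~~ beval x y e p.
Proof. by []. Qed.

Lemma beval_and x y e p q :
  beval x y e (BAnd p q) = beval x y e p && beval x y e q.
Proof. by []. Qed.

Lemma beval_imp x y e p q :
  beval x y e (bimp p q) = (beval x y e p ==> beval x y e q).
Proof. by rewrite /= negb_and negbK implybE. Qed.

Lemma beval_iff x y e p q :
  beval x y e (biff p q) = (beval x y e p == beval x y e q).
Proof.
rewrite /biff -[LHS]/(beval x y e (bimp p q) && beval x y e (bimp q p)).
by rewrite !beval_imp; case: (beval _ _ _ p); case: (beval _ _ _ q).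
Qed.

Lemma beval_batom x y e q ts :
  beval x y e (batom q ts) = holds y q [seq teval e t | t <- ts].
Proof.
rewrite /batom /holds /= teval_num addn1 -/(cpair _ _); congr (y (cpair _ _)).
by elim: ts => //= t ts ->.
Qed.

Definition values (e : nat -> nat) : seq nat := [seq e i | i <- iota 0 K].

Lemma size_values e : size (values e) = K.
Proof. by rewrite size_map size_iota. Qed.

Lemma nth_values e i : i < K -> nth 0 (values e) i = e i.
Proof. by move=> iK; rewrite (nth_map 0) ?size_iota // nth_iota. Qed.

Lemma eval_vars e : [seq teval e t | t <- vars] = values e.
Proof. by rewrite -map_comp. Qed.

Lemma eval_vars_but e v t : v < K ->
  [seq teval e u | u <- vars_but v t] = set_nth 0 (values e) v (teval e t).
Proof.
move=> vK; apply: (@eq_from_nth _ 0).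
  by rewrite !size_map size_iota size_update // size_values.
move=> i; rewrite !size_map size_iota => iK.
rewrite (nth_map TZero) ?size_map ?size_iota // (nth_map 0) ?size_iota //.
rewrite nth_iota // add0n nth_set_nth /=.
by case: eqP => //= _; rewrite nth_values.
Qed.

Lemma teval_values e t : tbound K t -> teval (nth 0 (values e)) t = teval e t.
Proof.
by move=> b; apply: (teval_ext b) => i iK; rewrite nth_values.
Qed.

Lemma beval_bcond x y e q : fbound K q ->
  beval x y e (bcond q) = cond x y (values e) (e K) (e K.+2) q.
Proof.
elim: q => [s t|s t|t [|[|X]]|p IH|p1 IH1 p2 IH2|v p IH] b.
- by case/andP: b => b1 b2; rewrite beval_iff beval_batom eval_vars /= !teval_values.
- by case/andP: b => b1 b2; rewrite beval_iff beval_batom eval_vars /= !teval_values.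
- by rewrite beval_iff beval_batom eval_vars /= !teval_values.
- by rewrite beval_iff beval_batom eval_vars /= !teval_values.
- by rewrite -[LHS]/(~~ beval x y e (batom _ _)) beval_batom eval_vars.
- by rewrite [bcond _]/= beval_and beval_iff beval_not !beval_batom eval_vars IH.
- case/andP: b => b1 b2.
  by rewrite [bcond _]/= beval_and beval_iff !beval_and !beval_batom eval_vars IH1 // IH2.
case/andP: b => vK b.
rewrite [bcond _]/= !beval_and !beval_imp !beval_not IH // !beval_batom.
rewrite eval_vars eval_vars_but //; congr [&& _, _ ==> ~~ _ & _]; apply: eq_all => j.
rewrite -[LHS]/(beval x y (upd e K.+3 j) (batom p (vars_but v (TVar K.+3)))).
rewrite beval_batom eval_vars_but //= upd_same.
congr (holds _ _ (set_nth _ _ _ _)); apply/eq_in_map => i.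
by rewrite mem_iota => iK; rewrite upd_diff //; lia.
Qed.

Lemma beval_foldr x y vs s e p : s \notin vs ->
  reflect (forall f, (forall i, i \in vs -> f i < e s) ->
                     (forall i, i \notin vs -> f i = e i) -> beval x y f p)
    (beval x y e (foldr (fun v => BAll v s) p vs)).
Proof.
elim: vs e => [|v vs IH] e /=.
  move=> _; apply: (iffP idP) => [h f _ fe|]; last by apply.
  by have -> : f = e by apply/funext => i; apply: fe.
rewrite inE negb_or => /andP[sv svs].
apply: (iffP allP) => [H f f1 f2|H j].
  have /(IH _ svs) : beval x y (upd e v (f v)) (foldr (fun v => BAll v s) p vs).
    by apply: H; rewrite mem_iota /= add0n; apply: f1; rewrite inE eqxx.
  apply=> i ivs; first by rewrite upd_diff //; apply: f1; rewrite inE ivs orbT.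
  by rewrite /upd; case: eqP => [->//|/eqP iv]; apply: f2; rewrite inE negb_or iv.
rewrite mem_iota /= add0n => js; apply/(IH _ svs) => f f1 f2.
rewrite upd_diff // in f1; apply: H => i; rewrite inE.
  case: (boolP (i \in vs)) => [/f1//|ivs]; rewrite orbF => /eqP iv.
  by rewrite f2 // iv upd_same.
by rewrite negb_or => /andP[iv ivs]; rewrite f2 // upd_diff.
Qed.

Definition below (s : nat) (l : seq nat) : Prop := forall i, i < K -> nth 0 l i < s.

Lemma beval_matrix x y s m p : fbound K p ->
  reflect ((forall l n, size l = K -> below s l -> n < s -> cond x y l n m p) /\
           holds y p (nseq K 0))
    (beval x y (loop_env K.+1 K.+2 s m) (bmatrix p)).
Proof.
move=> b; rewrite /bmatrix beval_and beval_batom map_nseq [teval _ _]/=.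
have Kn : K.+1 \notin iota 0 K.+1 by rewrite mem_iota; lia.
have es : loop_env K.+1 K.+2 s m K.+1 = s by rewrite /loop_env; supd.
have em : loop_env K.+1 K.+2 s m K.+2 = m by rewrite /loop_env; supd.
apply: (iffP andP) => -[H hp]; split=> //.
  move=> l n lK ls ns.
  pose f i := if i < K then nth 0 l i else if i == K then n else
    loop_env K.+1 K.+2 s m i.
  have := elimT (beval_foldr x y _ (bcond p) Kn) H f; rewrite es beval_bcond //.
  have -> : values f = l.
    apply: (@eq_from_nth _ 0); rewrite size_values // => i iK.
    by rewrite nth_values // /f iK.
  have -> : f K = n by rewrite /f ltnn eqxx.
  have -> : f K.+2 = m by rewrite /f em; do 2 (case: ifP; first lia).
  apply=> i; rewrite mem_iota => iK; rewrite /f.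
    case: ifP => [/ls//|]; by case: eqP => // iK' iK2; lia.
  by rewrite !ifF //; lia.
apply/(beval_foldr x y _ _ Kn) => f f1 f2; rewrite beval_bcond //.
rewrite es in f1; rewrite (f2 K.+2) ?em; last by rewrite mem_iota; lia.
apply: H; first exact: size_values.
  by move=> i iK; rewrite nth_values //; apply: f1; rewrite mem_iota; lia.
by apply: f1; rewrite mem_iota; lia.
Qed.

End Matrix.

(** With infinitely many successes the count passes any s, and a later success at a larger count
    gives [P s m] by monotonicity. With finitely many, the count gets stuck at some c; but a witness
    m for c stays a witness for all larger m, which forces another success. *)
Lemma often_successful (P : nat -> nat -> bool) (cnt : nat -> nat) :
  (forall s s' m m', s' <= s -> m <= m' -> P s m -> P s' m') ->
  cnt 0 = 0 -> (forall n, cnt n.+1 = cnt n + P (cnt n) n) ->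
  (forall N, exists2 n, N <= n & P (cnt n) n) <-> (forall s, exists m, P s m).
Proof.
move=> mono c0 cS; split=> [H s|H N].
  suff [n sn] : exists n, s <= cnt n.
    have [m nm Pm] := H n; exists m; apply: (mono _ _ _ _ _ (leqnn m) Pm).
    apply: leq_trans sn _; rewrite -(subnKC nm); elim: (m - n) => [|d IH].
      by rewrite addn0.
    by rewrite addnS cS (leq_trans IH) ?leq_addr.
  elim: s => [|s [n sn]]; first by exists 0.
  have [m nm Pm] := H n; exists m.+1; rewrite cS Pm addn1 ltnS.
  apply: leq_trans sn _; rewrite -(subnKC nm); elim: (m - n) => [|d IH].
    by rewrite addn0.
  by rewrite addnS cS (leq_trans IH) ?leq_addr.
apply: contrapT => nN.
have stuck n : N <= n -> cnt n = cnt N.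
  move=> Nn; rewrite -(subnKC Nn); elim: (n - N) => [|d IH]; first by rewrite addn0.
  rewrite addnS cS IH; case e: (P _ _); last by rewrite addn0.
  by case: nN; exists (N + d); rewrite ?leq_addr // IH.
have [m Pm] := H (cnt N); apply: nN; exists (N + m); first exact: leq_addr.
by rewrite stuck ?leq_addr //; apply: mono Pm => //; exact: leq_addl.
Qed.

Lemma map_val_ex s (l : seq nat) : (forall i, i < size l -> nth 0 l i < s) ->
  exists t : seq 'I_s, map val t = l.
Proof.
elim: l => [|a l IH] h; first by exists [::].
have [t et] : exists t : seq 'I_s, map val t = l by apply: IH => i; exact: (h i.+1).
by exists (Ordinal (h 0 isT) :: t); rewrite /= et.
Qed.

(** Collection: there are finitely many assignments and instances below s, and by [cond_mono] the
    maximum of their bounds serves them all. *)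
Lemma matrix_collect K x y p :
  (forall s, exists m,
     (forall l n, size l = K -> below K s l -> n < s -> cond x y l n m p) /\
     holds y p (nseq K 0)) <->
  (forall l n, size l = K -> exists m, cond x y l n m p) /\ holds y p (nseq K 0).
Proof.
split=> [H|[H hp] s].
  split; last by have [m []] := H 0.
  move=> l n lK; have [m [h _]] := H (n + \max_(i < K) nth 0 l i).+1.
  exists m; apply: h => //; last by lia.
  move=> i iK; rewrite ltnS.
  by apply: leq_trans (leq_addl _ _); exact: (leq_bigmax (Ordinal iK)).
have /choice [g gP] : forall u : K.-tuple 'I_s * 'I_s, exists m,
    cond x y (map val u.1) u.2 m p.
  by move=> [t n]; apply: H; rewrite size_map size_tuple.
exists (\max_u g u); split=> // l n lK ls ns.
have [|t et] := @map_val_ex s l; first by rewrite lK.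
have tK : size t == K by rewrite -lK -et size_map.
have := gP (Tuple tK, Ordinal ns); rewrite /= et.
by apply: cond_mono; exact: leq_bigmax.
Qed.

(** * Machines for analytic sets *)

Lemma tbound_num V n : tbound V (tnum n).
Proof. by elim: n => //= n ->. Qed.

Lemma bbound_batom V q ts : all (tbound V) ts -> bbound V (batom q ts).
Proof.
move=> h; rewrite /= tbound_num /=.
suff -> : tbound V (foldr TPair TZero ts) by [].
by elim: ts h => //= t ts IH /andP[-> /IH->].
Qed.

Lemma all_vars K V : K <= V -> all (tbound V) (vars K).
Proof.
by move=> KV; rewrite all_map; apply/allP => i; rewrite mem_iota /=; lia.
Qed.

Lemma all_vars_but K V v t : K <= V -> tbound V t -> all (tbound V) (vars_but K v t).
Proof.
move=> KV tV; rewrite all_map; apply/allP => i; rewrite mem_iota /=.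
by case: ifP => //=; lia.
Qed.

Lemma bbound_and V p q : bbound V (BAnd p q) = bbound V p && bbound V q.
Proof. by []. Qed.
Lemma bbound_not V p : bbound V (BNot p) = bbound V p.
Proof. by []. Qed.

Lemma bbound_imp V p q : bbound V (bimp p q) = bbound V p && bbound V q.
Proof. by []. Qed.

Lemma bbound_iff V p q : bbound V (biff p q) = bbound V p && bbound V q.
Proof.
by rewrite !bbound_and !bbound_not !bbound_and !bbound_not [X in _ && X]andbC andbb.
Qed.

Lemma bbound_bcond K q : fbound K q -> bbound K.+4 (bcond K q).
Proof.
have KV : K <= K.+4 by lia.
have va r : bbound K.+4 (batom r (vars K)) by apply: bbound_batom; exact: all_vars.
elim: q => [s t|s t|t [|[|X]]|p IH|p1 IH1 p2 IH2|v p IH] b; rewrite [bcond _ _]/=.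
- by rewrite bbound_iff va; case/andP: b => b1 b2 /=; rewrite !(tbound_mono KV).
- by rewrite bbound_iff va; case/andP: b => b1 b2 /=; rewrite !(tbound_mono KV).
- by rewrite bbound_iff va /= (tbound_mono KV).
- by rewrite bbound_iff va /= (tbound_mono KV).
- by rewrite bbound_not va.
- by rewrite bbound_and bbound_iff bbound_not !va IH.
- by case/andP: b => b1 b2; rewrite bbound_and bbound_iff !bbound_and !va IH1 // IH2.
case/andP: b => vK b; rewrite !bbound_and !bbound_imp !bbound_not IH // !va.
rewrite bbound_batom ?andbT; last by apply: all_vars_but => //=; lia.
rewrite -[bbound _ (BAll _ _ _)]/[&& _, _, _ & bbound _ (batom _ _)].
rewrite bbound_batom; last by apply: all_vars_but => //=; lia.
by lia.
Qed.

(** The machine searches for incoherence bounds of the table on the witness tape. Every run halts in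
    exactly the step omega, which explains the bound [osucc omega]. *)
Lemma Sigma11_NP a : olt (osucc omega) a -> Sigma11 `<=` NP_ a.
Proof.
move=> wa A [p Ap]; have [K b] := fbound_ex p.
pose Th := bmatrix K p.
have ThV : bbound K.+4 Th.
  rewrite /Th /bmatrix bbound_and bbound_batom ?andbT; last first.
    by elim: (X in nseq X) => //=.
  suff h vs : all (fun i => i <= K) vs ->
      bbound K.+4 (foldr (fun v => BAll v K.+1) (bcond K p) vs).
    by apply: h; apply/allP => i; rewrite mem_iota; lia.
  by elim: vs => [|v vs IH] /=; [rewrite bbound_bcond|move=> /andP[vK /IH->]; lia].
have SV : K.+1 < K.+4 by lia.
have MV : K.+2 < K.+4 by lia.
have SM : K.+1 != K.+2 by lia.
have [k ok] := cok_ex (loop_body K.+4 K.+1 K.+2 Th).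
have T x y := loop_accepts SV MV SM ThV x y ok.
exists (loop_machine K.+4 K.+1 K.+2 Th k), (osucc omega); split=> //.
  by move=> x y; exists omega; split; [exact: olt_succ|have [] := T x y].
have TE x y : accepts (loop_machine K.+4 K.+1 K.+2 Th k) x y <->
    (forall l n, size l = K -> exists m, cond x y l n m p) /\ holds y p (nseq K 0).
  have [_ ->] := T x y; rewrite -matrix_collect.
  set P := fun s m => beval x y (loop_env K.+1 K.+2 s m) Th.
  have PE s m : reflect ((forall l n, size l = K -> below K s l -> n < s ->
      cond x y l n m p) /\ holds y p (nseq K 0)) (P s m) by exact: beval_matrix.
  rewrite (often_successful (P := P) (cnt := loop_count K.+1 K.+2 Th x y)) //; last first.
    move=> s s' m m' ss mm /PE[h hp]; apply/PE; split=> // l n lK ls ns.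
    apply: (cond_mono mm); apply: h => //; last exact: leq_trans ss.
    by move=> i /ls h'; exact: leq_trans ss.
  by split=> H s; have [m /PE h] := H s; exists m => //; apply/PE.
move=> x; rewrite Ap; split=> [[Y hY]|[y /TE[H hp]]].
  have [y [_ [h1 h2]]] := cond_complete K x Y.
  exists y; apply/TE; split=> [l n lK|]; first exact: h2.
  apply/h1; first by rewrite size_nseq.
  suff -> : nth 0 (nseq K 0) = fun _ => 0 by [].
  by apply/funext => i; rewrite nth_nseq; case: ifP.
exists (fun n => y (cpair 0 n)); move: hp; rewrite (cond_sound b H) ?size_nseq //.
suff -> : nth 0 (nseq K 0) = fun _ => 0 by [].
by apply/funext => i; rewrite nth_nseq; case: ifP.
Qed.

(** * Implicit arithmetical definability *)

(** A richer syntax for describing runs, with all connectives and finite conjunctions over states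
    and tapes; [arith_of] translates it back. *)
Inductive fm : Type :=
| MBool (b : bool)
| MEq (s t : term)
| MLt (s t : term)
| MIn (t : term) (X : nat)
| MNot (p : fm)
| MAnd (p q : fm)
| MOr (p q : fm)
| MImp (p q : fm)
| MIff (p q : fm)
| MAll (v : nat) (p : fm)
| MEx (v : nat) (p : fm)
| MConj (T : finType) (F : T -> fm).

Fixpoint fsat (X : nat -> real) (e : nat -> nat) (p : fm) : Prop :=
  match p with
  | MBool b => b
  | MEq s t => teval e s = teval e t
  | MLt s t => teval e s < teval e t
  | MIn t i => X i (teval e t)
  | MNot p => ~ fsat X e p
  | MAnd p q => fsat X e p /\ fsat X e q
  | MOr p q => fsat X e p \/ fsat X e q
  | MImp p q => fsat X e p -> fsat X e q
  | MIff p q => fsat X e p <-> fsat X e q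
  | MAll v p => forall n, fsat X (upd e v n) p
  | MEx v p => exists n, fsat X (upd e v n) p
  | MConj T F => forall t, fsat X e (F t)
  end.

Definition FImp (p q : arith) : arith := FNot (FAnd p (FNot q)).

Fixpoint arith_of (p : fm) : arith :=
  match p with
  | MBool b => if b then FEq TZero TZero else FLt TZero TZero
  | MEq s t => FEq s t
  | MLt s t => FLt s t
  | MIn t i => FIn t i
  | MNot p => FNot (arith_of p)
  | MAnd p q => FAnd (arith_of p) (arith_of q)
  | MOr p q => FImp (FNot (arith_of p)) (arith_of q)
  | MImp p q => FImp (arith_of p) (arith_of q)
  | MIff p q => FAnd (FImp (arith_of p) (arith_of q)) (FImp (arith_of q) (arith_of p))
  | MAll v p => FAll v (arith_of p)
  | MEx v p => FNot (FAll v (FNot (arith_of p)))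
  | MConj T F => foldr FAnd (FEq TZero TZero) [seq arith_of (F t) | t <- enum T]
  end.

Lemma sat_imp X e p q : sat X e (FImp p q) <-> (sat X e p -> sat X e q).
Proof.
by split=> /= [h hp|h [hp nq]]; [apply: contrapT => nq; apply: h|apply: nq; apply: h].
Qed.

Lemma sat_and X e p q : sat X e (FAnd p q) <-> sat X e p /\ sat X e q.
Proof. by []. Qed.

Lemma sat_arith_of X e p : sat X e (arith_of p) <-> fsat X e p.
Proof.
elim: p e => [b|s t|s t|t i|p IH|p IHp q IHq|p IHp q IHq|p IHp q IHq|p IHp q IHq|
  v p IH|v p IH|T F IH] e //.
- by case: b; split.
- by rewrite /= IH.
- by rewrite /= IHp IHq.
- rewrite [arith_of _]/= sat_imp IHq /= IHp.
  by split=> [h|[h|//]]; [apply: contrapT => /not_orP[/h]|].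
- by rewrite [arith_of _]/= sat_imp IHp IHq.
- rewrite [arith_of _]/= sat_and !sat_imp IHp IHq.
  by split=> [[h1 h2]|h]; [split|split=> /h].
- by split=> h n; apply/IH; exact: h.
- split=> /= [h|[n hn] h].
    by apply: contrapT => /forallNP nh; apply: h => n /IH; exact: nh.
  by apply: (h n); exact/IH.
rewrite [arith_of _]/=; split=> [h t|h].
  have : t \in enum T by rewrite mem_enum.
  elim: (enum T) h => //= u s IHs [hu hs]; rewrite inE => /orP[/eqP->|]; last exact: IHs.
  exact/IH.
by elim: (enum T) => //= u s IHs; split=> //; apply/IH; exact: h.
Qed.

Fixpoint fren (f : nat -> nat) (p : fm) : fm :=
  match p with
  | MBool b => MBool b
  | MEq s t => MEq s t
  | MLt s t => MLt s t
  | MIn t i => MIn t (f i)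
  | MNot p => MNot (fren f p)
  | MAnd p q => MAnd (fren f p) (fren f q)
  | MOr p q => MOr (fren f p) (fren f q)
  | MImp p q => MImp (fren f p) (fren f q)
  | MIff p q => MIff (fren f p) (fren f q)
  | MAll v p => MAll v (fren f p)
  | MEx v p => MEx v (fren f p)
  | MConj T F => MConj (fun t : T => fren f (F t))
  end.

Lemma fsat_ren f X e p : fsat X e (fren f p) <-> fsat (X \o f) e p.
Proof.
elim: p e => [b|s t|s t|t i|p IH|p IHp q IHq|p IHp q IHq|p IHp q IHq|p IHp q IHq|
  v p IH|v p IH|T F IH] e //=.
- by rewrite IH.
- by rewrite IHp IHq.
- by rewrite IHp IHq.
- by rewrite IHp IHq.
- by rewrite IHp IHq.
- by split=> h n; apply/IH; exact: h.
- by split=> -[n h]; exists n; apply/IH.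
- by split=> h t; apply/IH; exact: h.
Qed.

Definition scons (x : real) (X : nat -> real) : nat -> real :=
  fun i => if i is j.+1 then X j else x.

(** Set 0 remains x, and the infinitely many other sets become the rows of one witness. *)
Fixpoint fcode (p : fm) : fm :=
  match p with
  | MBool b => MBool b
  | MEq s t => MEq s t
  | MLt s t => MLt s t
  | MIn t i => if i is j.+1 then MIn (TPair (tnum j) t) 1 else MIn t 0
  | MNot p => MNot (fcode p)
  | MAnd p q => MAnd (fcode p) (fcode q)
  | MOr p q => MOr (fcode p) (fcode q)
  | MImp p q => MImp (fcode p) (fcode q)
  | MIff p q => MIff (fcode p) (fcode q)
  | MAll v p => MAll v (fcode p)
  | MEx v p => MEx v (fcode p)
  | MConj T F => MConj (fun t : T => fcode (F t))
  end.

Lemma fsat_code x y e p :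
  fsat (set_xy x y) e (fcode p) <-> fsat (scons x (fun i n => y (cpair i n))) e p.
Proof.
elim: p e => [b|s t|s t|t i|p IH|p IHp q IHq|p IHp q IHq|p IHp q IHq|p IHp q IHq|
  v p IH|v p IH|T F IH] e //=.
- by case: i => [|i] //=; rewrite teval_num.
- by rewrite IH.
- by rewrite IHp IHq.
- by rewrite IHp IHq.
- by rewrite IHp IHq.
- by rewrite IHp IHq.
- by split=> h n; apply/IH; exact: h.
- by split=> -[n h]; exists n; apply/IH.
- by split=> h t; apply/IH; exact: h.
Qed.

Notation e0 := (fun _ : nat => 0).

Lemma rel_real (P : nat -> nat -> Prop) :
  exists Z : real, forall c k, Z (cpair c k) <-> P c k.
Proof.
exists (fun z => `[< exists c k, z = cpair c k /\ P c k >]) => c k.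
by split=> [/asboolP[c' [k' [/cpair_inj[-> ->]]]]//|h]; apply/asboolP; exists c, k.
Qed.

Lemma Sigma11_intro (A : set real) p :
  (forall x, A x <-> exists X, fsat (scons x X) e0 p) -> Sigma11 A.
Proof.
move=> h; exists (arith_of (fcode p)) => x; rewrite h; split=> [[X hX]|[y]].
  have [y hy] := rel_real (fun i n => X i n).
  exists y; apply/sat_arith_of/fsat_code.
  suff -> : (fun i n => y (cpair i n)) = X by [].
  by apply/funext => i; apply/funext => n; apply/idP/idP => /hy.
by move=> /sat_arith_of/fsat_code hy; eexists; exact: hy.
Qed.

(* The sets other than X 0 are auxiliary; they stand for the reals that are   *)
(* guessed along with X 0, such as the graphs of auxiliary functions.         *)
Definition defines (Q : real -> Prop) : Prop :=
  exists p, (exists X, fsat X e0 p) /\ forall X, fsat X e0 p -> Q (X 0).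

(** Implicit definitions compose: the definitions of the sets [Y i] are placed side by side under
    disjoint names, and [p] describes the new set in terms of them. *)
Lemma defines_step m (Qs : nat -> real -> Prop) (Q : real -> Prop) p :
  (forall i, i < m -> defines (Qs i)) ->
  (forall Y : nat -> real, (forall i, i < m -> Qs i (Y i)) ->
    exists Z, fsat (scons Z Y) e0 p) ->
  (forall (Y : nat -> real) (Z : real), (forall i, i < m -> Qs i (Y i)) ->
    fsat (scons Z Y) e0 p -> Q Z) ->
  defines Q.
Proof.
move=> dQ exZ hZ.
have /choice [g gP] : forall i, exists q, i < m ->
    (exists X, fsat X e0 q) /\ forall X, fsat X e0 q -> Qs i (X 0).
  move=> i; case: (ltnP i m) => [/dQ[q hq]|_]; first by exists q.
  by exists (MBool true).
(* Set [k] of the [j]-th definition is renamed [(pickle (j, k)).+1]; [p] sees only the sets with [k]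
   = 0. *)
pose f i := if i is j.+1 then (pickle (j, 0)).+1 else 0.
exists (MAnd (fren f p) (MConj (fun i : 'I_m => fren (fun k => (pickle (val i, k)).+1) (g i)))).
split.
  have /choice [X XP] : forall i, exists X, i < m -> fsat X e0 (g i).
    move=> i; case: (ltnP i m) => [/gP[[X hX] _]|_]; first by exists X.
    by exists (fun _ => blank).
  have [Z hZ'] : exists Z, fsat (scons Z (fun i => X i 0)) e0 p.
    by apply: exZ => i im; apply: (gP i im).2; exact: XP.
  exists (scons Z (fun z => if unpickle z is Some (i, k) then X i k else blank)).
  split; first (apply/fsat_ren; set X' := _ \o _).
    suff -> : X' = scons Z (fun i => X i 0) by [].
    by apply/funext => -[|i] //; rewrite /X' /= pickleK.
  move=> i; apply/fsat_ren; set X' := _ \o _.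
  suff -> : X' = X i by exact: XP.
  by apply/funext => k; rewrite /X' /= pickleK.
move=> X [/fsat_ren hp hg]; apply: (hZ (fun i => X (f i.+1))) => [i im|].
  by have /fsat_ren/(gP i im).2 := hg (Ordinal im).
suff -> : scons (X 0) (fun i => X (f i.+1)) = X \o f by [].
by apply/funext => -[].
Qed.

Lemma defines_explicit m (Qs : nat -> real -> Prop) (Q : real -> Prop) p :
  (forall i, i < m -> defines (Qs i)) ->
  (forall (Y : nat -> real) (Z : real), (forall i, i < m -> Qs i (Y i)) ->
    (forall c k, Z (cpair c k) <-> fsat Y (upd (upd e0 0 c) 1 k) p) -> Q Z) ->
  defines Q.
Proof.
move=> dQ hQ.
apply: (defines_step (p := MAll 0 (MAll 1 (MIff
  (MIn (TPair (TVar 0) (TVar 1)) 0) (fren succn p))))) dQ _ _ => [Y hY|Y Z hY hZ].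
  have [Z hZ] := rel_real (fun c k => fsat Y (upd (upd e0 0 c) 1 k) p).
  exists Z => c k.
  change (Z (cpair c k) <-> fsat (scons Z Y) (upd (upd e0 0 c) 1 k) (fren succn p)).
  by rewrite fsat_ren; exact: hZ.
apply: (hQ Y) => // c k; have := hZ c k.
change ((Z (cpair c k) <-> fsat (scons Z Y) (upd (upd e0 0 c) 1 k) (fren succn p)) ->
  (Z (cpair c k) <-> fsat Y (upd (upd e0 0 c) 1 k) p)).
by rewrite fsat_ren.
Qed.

(** * Graphs of recursive functions *)

Definition tcode d (l : seq nat) : nat := foldr cpair d l.

(* The arguments of h are the first entries of a code with any tail d, so     *)
(* that the arity of h need not be recognized by the defining formula.        *)
Definition graph n (h : n.-tuple nat -> nat) (Z : real) : Prop :=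
  forall (v : n.-tuple nat) d k, Z (cpair (tcode d v) k) <-> k = h v.

Fixpoint entry_of (i u r : nat) : Prop :=
  if i is j.+1 then exists a d, u = cpair a d /\ entry_of j d r
  else exists d, u = cpair r d.

Lemma entry_tcode d l i r : i < size l -> entry_of i (tcode d l) r <-> r = nth 0 l i.
Proof.
elim: l i => // a l IH [|i] /= il.
  by split=> [[d' /cpair_inj[]//]|->]; exists (tcode d l).
rewrite -(IH i il); split=> [[a' [d' [/cpair_inj[_ <-]]]]//|h].
by exists a, (tcode d l).
Qed.

Lemma entries_tcode l u : (forall i, i < size l -> entry_of i u (nth 0 l i)) ->
  exists d, u = tcode d l.
Proof.
elim: l u => [|a l IH] u h; first by exists u.
have [c uc] := h 0 isT.
have [i il|d dc] := IH c; last by exists d; rewrite uc dc.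
by have [a' [d' [/esym]]] := h i.+1 il; rewrite uc => /cpair_inj[_ <-].
Qed.

Fixpoint fentry (i v k w : nat) : fm :=
  if i is j.+1 then
    MEx w (MEx w.+1 (MAnd (MEq (TVar v) (TPair (TVar w) (TVar w.+1)))
                       (fentry j w.+1 k w.+2)))
  else MEx w (MEq (TVar v) (TPair (TVar k) (TVar w))).

Lemma fsat_entry X e i v k w : v < w -> k < w ->
  fsat X e (fentry i v k w) <-> entry_of i (e v) (e k).
Proof.
elim: i e v w => [|i IH] e v w vw kw /=.
  by split=> -[d]; supd => h; exists d; move: h; supd.
split=> -[a [d]] [h1 h2]; exists a, d; move: h1 h2; supd.
  by rewrite IH; [supd|lia|lia].
by move=> h1 h2; split=> //; rewrite IH; [supd|lia|lia].
Qed.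

(** Induction on the recursive definition. Only primitive recursion needs an implicit definition,
    since the new graph occurs in its own equations; the other clauses are explicit. *)
Lemma recursive_defines n (h : n.-tuple nat -> nat) : recursive h -> defines (graph h).
Proof.
elim=> {n h} [n h hE|h hE|n i h hE|m n f g h rf IHf rg IHg hE|n f g h rf IHf rg IHg h0 hS|
  n g h rg IHg hE].
- apply: (@defines_explicit 0 (fun _ _ => True) _ (MEq (TVar 1) TZero)) => // Y Z _ hZ v d k.
  by rewrite hZ hE.
- apply: (@defines_explicit 0 (fun _ _ => True) _ (MEx 2 (MEx 3
    (MAnd (MEq (TVar 0) (TPair (TVar 2) (TVar 3)))
      (MEq (TVar 1) (TAdd (TVar 2) TOne)))))) => // Y Z _ hZ v d k.
  rewrite hZ hE; case/tupleP: v => a v; rewrite theadE.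
  change ((exists a' d', tcode d [tuple of a :: v] = cpair a' d' /\ k = a' + 1) <-> k = a.+1).
  split=> [[a' [d' [/cpair_inj[-> _]]]]|->]; rewrite ?addn1 //.
  by exists a, (tcode d v); rewrite addn1.
- apply: (@defines_explicit 0 (fun _ _ => True) _ (fentry i 0 1 2)) => // Y Z _ hZ v d k.
  by rewrite hZ hE fsat_entry // entry_tcode ?size_tuple // (tnth_nth 0).
(* The intermediate tuple is any number whose first [m] entries are the values of the [g i]; by
   [entries_tcode] it codes that tuple with some tail, which a graph accepts. *)
- apply: (@defines_explicit m.+1 (fun i => if i is j.+1 then
      (fun Z => forall jm : j < m, graph (g (Ordinal jm)) Z) else graph f) _
    (MEx 2 (MAnd (MConj (fun i : 'I_m => MEx 3 (MAnd (fentry i 2 3 4)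
        (MIn (TPair (TVar 0) (TVar 3)) i.+1))))
      (MIn (TPair (TVar 2) (TVar 1)) 0)))).
    case=> [|j] // jm0; have jm : j < m := jm0.
    have [p [ex hp]] := IHg (Ordinal jm).
    exists p; split=> // X hX jm'; have -> : jm' = jm by exact: bool_irrelevance.
    exact: hp.
  move=> Y Z hY hZ v d k; rewrite hZ hE.
  have gY (i : 'I_m) r : Y i.+1 (cpair (tcode d v) r) <-> r = g i v.
    have := hY i.+1 (ltn_ord i); move=> /(_ (ltn_ord i)) /(_ v d r) ->.
    by have -> : Ordinal (ltn_ord i) = i by exact: val_inj.
  have fY := hY 0 isT.
  set w := [tuple g i v | i < m].
  have wE (i : 'I_m) : nth 0 w i = g i v by rewrite -tnth_nth tnth_mktuple.
  change ((exists u, (forall i : 'I_m, exists r,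
     fsat Y (upd (upd (upd (upd e0 0 (tcode d v)) 1 k) 2 u) 3 r) (fentry i 2 3 4) /\
     Y i.+1 (cpair (tcode d v) r)) /\ Y 0 (cpair u k)) <-> k = f w).
  split=> [[u [hu uk]]|->].
    have [i|d' ud] := @entries_tcode w u.
      rewrite size_tuple => im; have [r] := hu (Ordinal im).
      rewrite fsat_entry //= => -[er /(gY (Ordinal im)) rE].
      by move: er; rewrite rE -(wE (Ordinal im)).
    by move: uk; rewrite ud; move=> /fY.
  exists (tcode 0 w); split; last exact/fY.
  move=> i; exists (g i v); split; last exact/gY.
  by rewrite fsat_entry //; supd; apply/entry_tcode; rewrite ?size_tuple ?wE.
- apply: (@defines_step 2 (fun i => if i is 0 then graph f else graph g) _
    (MAnd
      (MAll 0 (MAll 1 (MIff (MIn (TPair (TPair TZero (TVar 0)) (TVar 1)) 0)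
                            (MIn (TPair (TVar 0) (TVar 1)) 1))))
      (MAll 0 (MAll 1 (MAll 2 (MIff
        (MIn (TPair (TPair (TAdd (TVar 2) TOne) (TVar 0)) (TVar 1)) 0)
        (MEx 3 (MAnd (MIn (TPair (TPair (TVar 2) (TVar 0)) (TVar 3)) 0)
          (MIn (TPair (TPair (TVar 2) (TPair (TVar 3) (TVar 0))) (TVar 1)) 2)))))))));
    first by case=> [|[]].
    move=> Y _.
    (* Recursion on the first argument solves the equations, for arbitrary [Y]; that solutions are
       the graph is proved below by induction. *)
    pose P := fix P j c k := if j is j'.+1 then
      exists r, P j' c r /\ Y 1 (cpair (cpair j' (cpair r c)) k) else Y 0 (cpair c k) : Prop.
    have [Z hZ] := rel_real (fun jc k => exists j c, jc = cpair j c /\ P j c k).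
    have ZE j c k : Z (cpair (cpair j c) k) <-> P j c k.
      rewrite hZ; split=> [[j' [c' [/cpair_inj[-> ->]]]]//|]; by exists j, c.
    exists Z; split; first by move=> c k; exact: (ZE 0).
    move=> c k j.
    change (Z (cpair (cpair (j + 1) c) k) <-> exists r, Z (cpair (cpair j c) r) /\
      Y 1 (cpair (cpair j (cpair r c)) k)).
    rewrite addn1 ZE; split=> -[r [h1 h2]]; exists r; split=> //; exact/ZE.
  move=> Y Z hY [H0 HS] v d k.
  have Y0 := hY 0 isT; have Y1 := hY 1 isT.
  case/tupleP: v => j v; elim: j k => [|j IH] k.
    by have := H0 (tcode d v) k; rewrite h0 -Y0; exact.
  have := HS (tcode d v) k j.
  change ((Z (cpair (cpair (j + 1) (tcode d v)) k) <->
    exists r, Z (cpair (cpair j (tcode d v)) r) /\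
      Y 1 (cpair (cpair j (cpair r (tcode d v))) k)) ->
    (Z (cpair (tcode d [tuple of j.+1 :: v]) k) <-> k = h [tuple of j.+1 :: v])).
  rewrite addn1 hS => ->.
  have E r : Y 1 (cpair (cpair j (cpair r (tcode d v))) k) <->
      k = g [tuple of j :: r :: v] by exact: (Y1 [tuple of j :: r :: v]).
  split=> [[r [/IH-> /E]]//|kE].
  by exists (h [tuple of j :: v]); split; [exact/IH|exact/E].
apply: (@defines_explicit 1 (fun _ => graph g) _
  (MAnd (MIn (TPair (TPair (TVar 1) (TVar 0)) TZero) 0)
    (MAll 2 (MImp (MLt (TVar 2) (TVar 1))
      (MNot (MIn (TPair (TPair (TVar 2) (TVar 0)) TZero) 0)))))) => // Y Z hY hZ v d k.
have Y0 j : Y 0 (cpair (cpair j (tcode d v)) 0) <-> 0 = g [tuple of j :: v].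
  exact: (hY 0 isT [tuple of j :: v]).
rewrite hZ.
change (Y 0 (cpair (cpair k (tcode d v)) 0) /\
  (forall j, j < k -> ~ Y 0 (cpair (cpair j (tcode d v)) 0)) <-> k = h v).
have [g0 gn] := hE v; split=> [[/Y0 k0 hk]|->].
  apply/eqP; rewrite eqn_leq; apply/andP; split; rewrite leqNgt; apply/negP => lt.
    by apply: (hk _ lt); apply/Y0.
  by apply: (gn _ lt).
by split=> [|j jh]; [exact/Y0|move=> /Y0/esym; exact: gn].
Qed.

(** * Definable well-orders *)

(* Z codes the domain and the order relation of a notation system whose       *)
(* values are exactly the ordinals below a.                                   *)
Definition wocode (a : ord) (Z : real) : Prop := exists r : nat -> ord,
  [/\ forall n, Z (cpair 0 n) -> olt (r n) a,
      forall m n, Z (cpair 0 m) -> Z (cpair 0 n) ->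
        (Z (cpair 1 (cpair m n)) <-> olt (r m) (r n))
    & forall o, olt o a -> exists2 n, Z (cpair 0 n) & oeq (r n) o].

Definition covered (a : ord) : Prop :=
  forall b, olt b a -> exists2 a', olt b a' & defines (wocode a').

Lemma covered_le a b : ole a b -> covered b -> covered a.
Proof. by move=> ab cb o /olt_le_trans/(_ ab)/cb. Qed.

Section Rank.
Variables (T : Type) (R : T -> T -> Prop) (wf : well_founded R).
Local Notation rank u := (acc_rank (wf u)).

Lemma olt_rank o u : olt o (rank u) <-> exists2 v, R v u & ole o (rank v).
Proof.
have -> : rank u = Sup (fun v : {v | R v u} => rank (proj1_sig v)).
  case: (wf u) => h /=; congr Sup; apply/funext => -[v vu] /=.
  by congr acc_rank; exact: Prop_irrelevance.
split=> [[[v vu] h]|[v vu h]]; first by exists v.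
by exists (exist _ v vu).
Qed.

Hypothesis R_total : forall u v, u = v \/ R u v \/ R v u.

Lemma rank_lt u v : R u v <-> olt (rank u) (rank v).
Proof.
have lt w w' : R w w' -> olt (rank w) (rank w').
  by move=> ww; apply/olt_rank; exists w => //; exact: ole_refl.
split=> [|uv]; first exact: lt.
have [e|[//|/lt vu]] := R_total u v; first by move: uv; rewrite e => /olt_irrefl.
by case: (olt_irrefl (olt_trans uv vu)).
Qed.

(** Ranks form an initial segment of the ordinals, as [wocode] requires. *)
Lemma rank_onto o u : olt o (rank u) -> exists v, oeq (rank v) o.
Proof.
elim/(well_founded_induction wf): u => u IH /olt_rank [v vu /ole_eqVlt [ov|/IH]].
  by exists v; exact: oeq_sym.
exact.
Qed.

End Rank.

Lemma defines_wo (W : recursive_wo) : defines (wocode (otype (@wo_wf W))).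
Proof.
pose Qs i := if i is 0 then graph (fun v : 1.-tuple nat => nat_of_bool (wo_dom W (thead v)))
  else graph (fun v : 2.-tuple nat =>
    nat_of_bool (wo_rel W (tnth v ord0) (tnth v ord_max))).
apply: (@defines_explicit 2 Qs _ (MOr
  (MAnd (MEq (TVar 0) TZero) (MIn (TPair (TPair (TVar 1) TZero) TOne) 0))
  (MAnd (MEq (TVar 0) TOne) (MEx 2 (MEx 3 (MAnd (MEq (TVar 1) (TPair (TVar 2) (TVar 3)))
     (MIn (TPair (TPair (TVar 2) (TPair (TVar 3) TZero)) TOne) 1))))))).
  case=> [|[|]] // _; apply: recursive_defines; [exact: wo_dom_rec|exact: wo_rel_rec].
move=> Y Z hY hZ; have Y0 := hY 0 isT; have Y1 := hY 1 isT.
have ZE c k : Z (cpair c k) <->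
  (c = 0 /\ Y 0 (cpair (cpair k 0) 1)) \/
  (c = 1 /\ exists a b, k = cpair a b /\ Y 1 (cpair (cpair a (cpair b 0)) 1)).
  exact: hZ.
have Z0 n : Z (cpair 0 n) <-> wo_dom W n.
  have := Y0 [tuple n] 0 1; rewrite theadE => E; rewrite ZE.
  split=> [[[_ /E]|[]//]|h]; first by case: wo_dom.
  by left; split=> //; apply/E; rewrite h.
have Z1 m n : Z (cpair 1 (cpair m n)) <-> wo_rel W m n.
  have := Y1 [tuple m; n] 0 1; rewrite !(tnth_nth 0) /= => E; rewrite ZE.
  split=> [[[]//|[_ [m' [n' [/cpair_inj[<- <-] /E]]]]]|h]; first by case: wo_rel.
  by right; split=> //; exists m, n; split=> //; apply/E; rewrite h.
pose r n := if insub n is Some u then acc_rank (@wo_wf W u) else ozero.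
have rE (u : {n | wo_dom W n}) : r (val u) = acc_rank (@wo_wf W u) by rewrite /r valK.
exists r; split.
- move=> n /Z0 nD; rewrite -[n]/(val (Sub n nD : {n | wo_dom W n})) rE.
  by exists (Sub n nD); exact: ole_refl.
- move=> m n /Z0 mD /Z0 nD; rewrite Z1.
  pose u : {n | wo_dom W n} := Sub m mD; pose v : {n | wo_dom W n} := Sub n nD.
  rewrite -[m]/(val u) -[n]/(val v) !rE -rank_lt //; exact: wo_total.
move=> o ho.
have [u h] : exists u : {n | wo_dom W n}, ole o (acc_rank (@wo_wf W u)) := ho.
have [ou|lt] := ole_eqVlt h.
  exists (val u); [by apply/Z0; exact: valP|by rewrite rE; exact: oeq_sym].
have [v vo] := rank_onto lt.
by exists (val v); [apply/Z0; exact: valP|rewrite rE].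
Qed.

Lemma covered_omega1ck : covered omega1ck.
Proof.
by move=> b /olt_supP[W bW]; exists (otype (@wo_wf W)) => //; exact: defines_wo.
Qed.

(** * Ordinal arithmetic and the orders omega ^ j *)

Lemma olt_add o a b : olt o (oadd a b) <->
  olt o a \/ exists2 b', olt b' b & ole o (oadd a b').
Proof.
split.
  case: b => B g [[i|j] h]; first by left; exists i.
  by right; exists (g j) => //; exact: (@olt_child (Sup g) j).
have mono b1 b2 : ole b1 b2 -> ole (oadd a b1) (oadd a b2).
  elim: b1 b2 => B1 g1 IH [B2 g2] h; apply/ole_childP => -[i|j] /=.
    by exists (inl i); exact: ole_refl.
  by have [k jk] := h j; exists (inr k); apply: IH.
case=> [[i h]|[b' [j bj] h]].
  by case: b => B g; exists (inl i).
case: b j bj h => B g j bj h; exists (inr j) => /=.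
by apply: ole_trans h _; apply: mono.
Qed.

Lemma ole_addl a b : ole a (oadd a b).
Proof. by apply/ole_ltP => o oa; apply/olt_add; left. Qed.

Lemma olt_add2 a b b' : olt b b' -> olt (oadd a b) (oadd a b').
Proof. by move=> bb; apply/olt_add; right; exists b => //; exact: ole_refl. Qed.

Lemma ole_add2 a b b' : ole b b' -> ole (oadd a b) (oadd a b').
Proof.
move=> bb; apply/ole_ltP => o /olt_add [oa|[c cb oc]]; apply/olt_add; first by left.
by right; exists c => //; exact: olt_le_trans bb.
Qed.

Lemma ole_addr a b : ole b (oadd a b).
Proof.
elim: b => B g IH; apply/ole_childP => j; exists (inr j); exact: IH.
Qed.

Lemma olt_mulS a n p : olt p a ->
  olt (oadd (omul a (onat n)) p) (omul a (onat n.+1)).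
Proof. by case=> i pi; exists (i, tt); exact: ole_add2. Qed.

Lemma olt_mul_omega o a : olt o (omul a omega) <->
  exists n, exists2 p, olt p a & ole o (oadd (omul a (onat n)) p).
Proof.
split=> [[[i n] h]|[n [p [i pi] h]]].
  by exists n, (child i) => //; exact: olt_child.
by exists (i, n); apply: ole_trans h _; exact: ole_add2.
Qed.

Lemma olt_mul_succ o a n : olt o (omul a (onat n.+1)) ->
  exists2 p, olt p a & ole o (oadd (omul a (onat n)) p).
Proof. by case=> -[i []] h; exists (child i) => //; exact: olt_child. Qed.

Lemma olt_mul_zero o a : ~ olt o (omul a (onat 0)).
Proof. by case=> -[_ []]. Qed.

Lemma ole_mul_onat a m n p : olt p a -> m <= n ->
  ole (omul a (onat m)) (omul a (onat n)).
Proof.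
move=> pa; elim: n => [|n IH]; first by rewrite leqn0 => /eqP->; exact: ole_refl.
rewrite leq_eqVlt => /orP[/eqP->|]; first exact: ole_refl.
rewrite ltnS => /IH h; apply: ole_trans h _; apply: oltW.
by apply: ole_lt_trans (olt_mulS n pa); exact: ole_addl.
Qed.

Lemma wocode_eq a b Z : oeq a b -> wocode a Z -> wocode b Z.
Proof.
move=> ab [r [h1 h2 h3]]; exists r; split=> //.
  by move=> n /h1; exact: olt_eqr.
by move=> o ob; apply: h3; apply: (olt_eqr (oeq_sym ab)).
Qed.

Lemma defines_imp (Q Q' : real -> Prop) :
  (forall Z, Q Z -> Q' Z) -> defines Q -> defines Q'.
Proof. by move=> h [p [e hp]]; exists p; split=> // X /hp/h. Qed.

Lemma defines_one : defines (wocode (onat 1)).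
Proof.
apply: (@defines_explicit 0 (fun _ _ => True) _
  (MAnd (MEq (TVar 0) TZero) (MEq (TVar 1) TZero))) => // Y Z _ hZ.
have ZE c k : Z (cpair c k) <-> c = 0 /\ k = 0 by exact: hZ.
exists (fun _ => ozero); split=> [n _|m n _ _|o].
- exact: olt_succ.
- by rewrite ZE; split=> [[]//|/olt_zero].
move=> /olt_succP o0; exists 0; first exact/ZE.
by split=> //; exact: ole0.
Qed.

(** Pairs (q, p) in lexicographic order, with [p] a notation below [a], denote the ordinals [a] * q
    + r p. *)
Lemma defines_mul_omega a :
  defines (wocode a) -> defines (wocode (omul a omega)).
Proof.
move=> da; apply: (@defines_explicit 1 (fun _ => wocode a) _ (MOr
  (MAnd (MEq (TVar 0) TZero) (MEx 2 (MEx 3 (MAnd (MEq (TVar 1) (TPair (TVar 2) (TVar 3)))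
    (MIn (TPair TZero (TVar 3)) 0)))))
  (MAnd (MEq (TVar 0) TOne) (MEx 2 (MEx 3 (MEx 4 (MEx 5 (MAnd
    (MEq (TVar 1) (TPair (TPair (TVar 2) (TVar 3)) (TPair (TVar 4) (TVar 5))))
    (MOr (MLt (TVar 2) (TVar 4)) (MAnd (MEq (TVar 2) (TVar 4))
      (MIn (TPair TOne (TPair (TVar 3) (TVar 5))) 0)))))))))))  => // Y Z hY hZ.
have ZE c k : Z (cpair c k) <->
  (c = 0 /\ exists q p, k = cpair q p /\ Y 0 (cpair 0 p)) \/
  (c = 1 /\ exists q p q' p', k = cpair (cpair q p) (cpair q' p') /\
    (q < q' \/ (q = q' /\ Y 0 (cpair 1 (cpair p p'))))) by exact: hZ.
have [r [h1 h2 h3]] := hY 0 isT.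
have Z0 q p : Z (cpair 0 (cpair q p)) <-> Y 0 (cpair 0 p).
  rewrite ZE; split=> [[[_ [q' [p' [/cpair_inj[_ ->]//]]]]|[]//]|h].
  by left; split=> //; exists q, p.
have Z0E z : Z (cpair 0 z) -> exists q, exists2 p, z = cpair q p & Y 0 (cpair 0 p).
  by move=> /ZE[[_ [q [p [-> h]]]]|[]//]; exists q, p.
have Z1 q p q' p' : Z (cpair 1 (cpair (cpair q p) (cpair q' p'))) <->
    q < q' \/ (q = q' /\ Y 0 (cpair 1 (cpair p p'))).
  rewrite ZE; split=> [[[]//|[_ [q1 [p1 [q2 [p2 []]]]]]]|h].
    by move=> /cpair_inj[/cpair_inj[-> ->] /cpair_inj[-> ->]].
  by right; split=> //; exists q, p, q', p'.
have [s sE] : exists s : nat -> ord, forall q p,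
    s (cpair q p) = oadd (omul a (onat q)) (r p).
  have /choice [s sP] : forall z, exists o, forall q p, z = cpair q p ->
      o = oadd (omul a (onat q)) (r p).
    move=> z; have [[q [p ->]]|nz] := pselect (exists q p, z = cpair q p).
      by exists (oadd (omul a (onat q)) (r p)) => q' p' /cpair_inj[-> ->].
    by exists ozero => q p zE; case: nz; exists q, p.
  by exists s => q p; exact: sP.
have lt q p q' p' : Y 0 (cpair 0 p) -> q < q' -> olt (s (cpair q p)) (s (cpair q' p')).
  move=> /h1 pa qq; rewrite !sE; apply: olt_le_trans (olt_mulS q pa) _.
  by apply: ole_trans (ole_mul_onat pa qq) _; exact: ole_addl.
exists s; split.
- move=> _ /Z0E[q [p -> /h1 pa]]; rewrite sE; apply/olt_mul_omega.
  by exists q, (r p) => //; exact: ole_refl.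
- move=> _ _ /Z0E[q [p -> Yp]] /Z0E[q' [p' -> Yp']]; rewrite Z1.
  case: (ltngtP q q') => [qq|qq|<-].
  + by split=> _; [exact: lt|left].
  + split=> [[//|[]]|/(olt_trans (lt _ _ _ _ Yp' qq))/olt_irrefl//]; lia.
  rewrite h2 // !sE; split=> [[//|[_]]|h]; first exact: olt_add2.
  by right; split=> //; apply/oltNge => le; move/oltNge: h; apply; exact: ole_add2.
move=> o /olt_mul_omega [n [c ca oc]].
suff [q [p Yp e]] : exists q, exists2 p, Y 0 (cpair 0 p) & oeq (s (cpair q p)) o.
  by exists (cpair q p) => //; exact/Z0.
(* Either [o] equals [a] * n + c and a notation for [c] gives the pair, or it is below [a] * n, or
   at most [a] * n + c' with c' < c. *)
elim: n c ca oc => [|n IHn] c ca oc; elim/olt_ind: c => c IHc in ca oc *;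
  case: (ole_eqVlt oc) => [e|/olt_add[|[c' cc]]].
- have [p Yp pc] := h3 _ ca; exists 0, p => //; rewrite sE; apply: oeq_trans (oeq_sym e).
  by case: pc => *; split; exact: ole_add2.
- by move=> /olt_mul_zero.
- by apply: IHc => //; exact: olt_trans ca.
- have [p Yp pc] := h3 _ ca; exists n.+1, p => //; rewrite sE; apply: oeq_trans (oeq_sym e).
  by case: pc => *; split; exact: ole_add2.
- by move=> /olt_mul_succ[c' ca' oc']; exact: IHn oc'.
- by apply: IHc => //; exact: olt_trans ca.
Qed.

Lemma olt_exp_succ o j : olt o (oexp omega (onat j.+1)) <->
  olt o (onat 1) \/ olt o (omul (oexp omega (onat j)) omega).
Proof.
split=> [/olt_supP[[[]|] h]|h]; [by right|by left|].
by apply/olt_supP; case: h => h; [exists None|exists (Some tt)].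
Qed.

Lemma exp_gt0 b : olt ozero (oexp omega b).
Proof. by case: b => B g; apply/olt_supP; exists None; exact: olt_succ. Qed.

Lemma mul_omega_gt0 a : olt ozero a -> olt ozero (omul a omega).
Proof.
by move=> a0; apply/olt_mul_omega; exists 0, ozero => //; exact: ole0.
Qed.

Lemma defines_exp j : defines (wocode (oexp omega (onat j))).
Proof.
elim: j => [|j /defines_mul_omega].
  apply: defines_imp defines_one => Z; apply: wocode_eq; split; apply/ole_ltP => o.
    by move=> h; apply/olt_supP; exists None.
  by move=> /olt_supP[[[]|]].
apply: defines_imp => Z; apply: wocode_eq; split; apply/ole_ltP => o.
  by move=> h; apply/olt_exp_succ; right.
move=> /olt_exp_succ[/olt_succP o0|//]; apply: ole_lt_trans o0 _.
by apply: mul_omega_gt0; exact: exp_gt0.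
Qed.

Lemma covered_omega_omega : covered (oexp omega omega).
Proof.
move=> b /olt_supP[[j|] bj]; last by exists (onat 1) => //; exact: defines_one.
exists (omul (oexp omega (onat j)) omega) => //.
by apply: defines_mul_omega; exact: defines_exp.
Qed.

Lemma ole_omega_mul a : olt ozero a -> ole omega (omul a omega).
Proof.
move=> a0; apply/ole_ltP => o /olt_omegaP[n [on _]].
have le : ole (onat n) (omul a (onat n)).
  elim: n {on} => [|n IH]; first exact: ole0.
  apply/ole_succP; apply: ole_lt_trans IH _; apply: ole_lt_trans (olt_mulS n a0).
  exact: ole_addl.
apply/olt_mul_omega; exists n, ozero => //.
by apply: ole_trans on _; apply: ole_trans le _; exact: ole_addl.
Qed.

Lemma omega_succ_lt : olt (osucc omega) (oexp omega omega).
Proof.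
pose a := oexp omega (onat 1); have a0 : olt ozero a := exp_gt0 _.
apply/olt_supP; exists (Some 1); apply/olt_mul_omega; exists 2, ozero => //.
apply: ole_trans (ole_addl _ _); apply/ole_succP.
apply: ole_lt_trans (olt_mulS 1 a0); apply: ole_trans (ole_addl _ _).
suff wa : ole omega a.
  apply: ole_trans wa _; apply/ole_ltP => o [i oi]; exists (i, tt) => /=.
  by apply: ole_trans oi _; exact: ole_addr.
apply/ole_ltP => o oa; apply/olt_exp_succ; right.
by apply: olt_le_trans oa _; apply: ole_omega_mul; exact: exp_gt0.
Qed.

Lemma omega2_le : ole (oadd omega (onat 2)) (oexp omega omega).
Proof.
apply/ole_ltP => o /olt_add[ow|[b /olt_succP b1 ob]].
  by apply: olt_trans omega_succ_lt; apply: olt_trans ow _; exact: olt_succ.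
apply: ole_lt_trans omega_succ_lt; apply: ole_trans ob _.
apply/ole_ltP => o' /olt_add[ow|[c cb oc]]; first exact: olt_trans (olt_succ _).
apply/olt_succP; apply: ole_trans oc _; apply/ole_ltP => o2 /olt_add[//|[d dc _]].
have /olt_succP/(olt_le_trans dc)/olt_zero// : olt c (onat 1) by exact: olt_le_trans b1.
Qed.

Lemma omega_succ_lt2 : olt (osucc omega) (oadd omega (onat 2)).
Proof.
apply/olt_add; right; exists (onat 1); first exact: olt_succ.
apply/ole_succP; apply/olt_add; right; exists ozero; first exact: olt_succ.
exact: ole_addl.
Qed.

(** * Coded computations *)

Section RunCode.
Variables (T : ittm) (x y : real).
Variables (D : nat -> Prop) (R : nat -> nat -> Prop).
Variables (S : ittm_state T -> nat -> Prop) (H : nat -> nat -> Prop).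
Variable (C : 'I_(ntapes T) -> nat -> nat -> Prop).

Definition rbefore m n : Prop := D m /\ R m n.
Definition rhalt n : Prop := S (q_accept T) n \/ S (q_reject T) n.
(* Nothing is required of the nodes that come after a halting one.            *)
Definition ralive n : Prop := forall m, rbefore m n -> ~ rhalt m.
Definition rstate (q : ittm_state T) n : Prop := forall q', S q' n <-> q' == q.
Definition rinit n : Prop :=
  [/\ rstate (q_start T) n, (forall h, H n h <-> h = 0) &
      forall i p, C i n p <-> nth blank [:: x; y] i p].
Definition rmove (d : move) (h' h : nat) : Prop :=
  match d with
  | MoveL => h' + 1 = h \/ (h = 0 /\ h' = 0)
  | MoveR => h' = h + 1
  end.
Definition rstep m n : Prop :=
  forall q (w : (ntapes T).-tuple bool) h,
    S q m /\ (H m h /\ forall i, C i m h <-> tnth w i) ->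
    let t := ittm_trans q w in
    [/\ rstate t.1.1 n, (forall h', H n h' <-> rmove t.2 h' h) &
      forall i p, C i n p <-> (p = h /\ tnth t.1.2 i) \/ (~ p = h /\ C i m p)].
(** On nodes, the negation of [R k m] says that [k] is not before [m]; the last clause is the
    limsup. *)
Definition rlimit n : Prop :=
  [/\ rstate (q_limit T) n, (forall h, H n h <-> h = 0) &
      forall i p, C i n p <-> forall m, rbefore m n ->
        exists k, rbefore k n /\ (~ R k m /\ C i k p)].
Definition rrun : Prop := forall n, D n /\ ralive n ->
  [/\ (~ (exists m, rbefore m n) -> rinit n),
      (forall m, rbefore m n /\ (forall k, rbefore k n -> ~ R m k) -> rstep m n) &
      ((exists m, rbefore m n) /\
         (forall m, rbefore m n -> exists k, rbefore k n /\ R m k) -> rlimit n)].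
Definition raccept : Prop := exists n, (D n /\ ralive n) /\ S (q_accept T) n.

Definition codes n (c : config T) : Prop :=
  [/\ rstate (c_state c) n, (forall h, H n h <-> h = c_head c) &
      forall i p, C i n p <-> c_tape c i p].

Lemma codes_init n : rinit n <-> codes n (init_config T x y).
Proof. by []. Qed.

Lemma codes_step m n c : codes m c -> (rstep m n <-> codes n (step c)).
Proof.
move=> [cs ch ct]; rewrite /step.
set w := [tuple c_tape c i (c_head c) | i < ntapes T].
have mE d h : rmove d h (c_head c) <->
    h = match d with MoveL => (c_head c).-1 | MoveR => (c_head c).+1 end.
  by case: d => /=; lia.
split=> [st|].
  have := st (c_state c) w (c_head c); case: ittm_trans => -[q' w'] d /=.
  case=> [|s1 s2 s3].
    split; first exact/cs; split; first exact/ch.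
    by move=> i; rewrite ct tnth_mktuple.
  split=> //= [h|i p]; first by rewrite s2 mE.
  rewrite s3; case: eqP => pE; last by rewrite ct; split=> [[[]|[]]|]; auto.
  by split=> [[[]|[]]|]; auto.
move=> + q v h [/cs/eqP-> [/ch->]] hv.
have -> : v = w.
  apply: eq_from_tnth => i; rewrite tnth_mktuple.
  by apply/idP/idP => [/hv/ct|/ct/hv].
case: ittm_trans => -[q' w'] d [s1 s2 s3] /=; split=> // [h'|i p].
  by rewrite s2 mE.
rewrite s3 /=; case: eqP => pE; last by rewrite ct; split=> [|[[]|[]]]; auto.
by split=> [|[[]|[]]]; auto.
Qed.

Variable r : nat -> ord.
Hypothesis rR : forall m n, D m -> D n -> (R m n <-> olt (r m) (r n)).
Hypothesis rD : forall n o, D n -> olt o (r n) -> exists2 m, D m & oeq (r m) o.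

Lemma before_lt m n : D n -> rbefore m n <-> D m /\ olt (r m) (r n).
Proof. by move=> Dn; split=> -[Dm h]; split=> //; apply/(rR Dm Dn). Qed.

(** The nodes before [n] name exactly the ordinals below [r n], so cofinality among nodes and among
    ordinals coincide. *)
Lemma codes_limit n h : D n ->
  (forall b, olt b (r n) -> stage x y b (h b)) ->
  (forall m, rbefore m n -> codes m (h (r m))) ->
  (rlimit n <-> codes n (limit_config (r n) h)).
Proof.
move=> Dn hs hc.
have ge k m : D k -> D m -> ~ R k m <-> ole (r m) (r k).
  by move=> Dk Dm; rewrite rR // oleNgt.
have hE b d : olt b (r n) -> oeq b d -> h b = h d.
  move=> bn bd; apply: (stage_det (hs _ bn) bd); apply: hs.
  exact: olt_eqr (oeq_refl _) (olt_eql bd bn).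
have E i p : (forall m, rbefore m n ->
        exists k, rbefore k n /\ (~ R k m /\ C i k p)) <->
    c_tape (limit_config (r n) h) i p.
  split=> [A|/asboolP A m mn].
    apply/asboolP => b bn; have [m Dm mb] := rD Dn bn.
    have mn : rbefore m n by apply/before_lt => //; split=> //; exact: olt_eql (oeq_sym mb) bn.
    have [k [kn [km Ck]]] := A _ mn.
    have [Dk kn'] := (before_lt k Dn).1 kn.
    exists (r k); split=> //; last by have [_ _ <-] := hc _ kn.
    by apply: ole_trans (proj2 mb) _; apply/ge.
  have [Dm mn'] := (before_lt m Dn).1 mn.
  have [g [mg gn hg]] := A _ mn'; have [k Dk kg] := rD Dn gn.
  have kn : rbefore k n by apply/before_lt => //; split=> //; exact: olt_eql (oeq_sym kg) gn.
  exists k; split=> //; split.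
    by apply/ge => //; apply: ole_trans mg (proj2 kg).
  by have [_ _ ->] := hc _ kn; rewrite -(hE g) //; exact: oeq_sym.
by split=> -[s1 s2 s3]; split=> // i p; rewrite s3 E.
Qed.

(** Zero, successor and limit are recognized from the order of the nodes alone, which makes [rrun]
    arithmetical. *)
Lemma node_cases n : D n ->
  [\/ ~ (exists m, rbefore m n) /\ oeq (r n) ozero,
      exists m, (rbefore m n /\ forall k, rbefore k n -> ~ R m k) /\
                oeq (r n) (osucc (r m)) |
      ((exists m, rbefore m n) /\
         (forall m, rbefore m n -> exists k, rbefore k n /\ R m k)) /\ olimit (r n)].
Proof.
move=> Dn.
have below o : olt o (r n) -> exists2 m, rbefore m n & oeq (r m) o.
  move=> on; have [m Dm mo] := rD Dn on; exists m => //.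
  by apply/before_lt => //; split=> //; exact: olt_eql (oeq_sym mo) on.
have [n0|[b nb]|nl] := ord_cases (r n).
- constructor 1; split=> // -[m /(before_lt _ Dn)[_ /olt_le_trans/(_ (proj1 n0))]].
  exact: olt_zero.
- have [|m mn mb] := below b; first by apply: olt_eqr (olt_succ b); exact: oeq_sym.
  have nm : oeq (r n) (osucc (r m)).
    apply: oeq_trans nb _; case: mb => h1 h2.
    by split; apply/ole_succP/olt_succP.
  constructor 2; exists m; split=> //; split=> // k kn.
  have [Dk kn'] := (before_lt k Dn).1 kn; rewrite rR //; last by case: mn.
  have /olt_succP := olt_eqr nm kn'.
  by move=> /oleNgt.
constructor 3; split=> //; split.
  by have [m mn _] := below _ nl.1; exists m.
move=> m mn; have [Dm mn'] := (before_lt m Dn).1 mn.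
have [k kn ks] := below _ (nl.2 _ mn'); exists k; split=> //.
by apply/rR => //; [case: kn|apply: (olt_eqr (oeq_sym ks)); exact: olt_succ].
Qed.

Lemma codes_halt n c : codes n c -> rhalt n <-> halted c.
Proof.
move=> [cs _ _]; rewrite /rhalt /halted !inE !cs ![_ == c_state c]eq_sym.
by split=> [/orP|/orP].
Qed.

(** Induction on the value of the node: earlier nodes are alive too and code non-halting stages, so
    the condition at [n] forces the next stage. *)
Lemma run_sound n : rrun -> D n -> ralive n ->
  exists2 c, stage x y (r n) c & codes n c.
Proof.
move=> run; have [o] : exists o, o = r n by exists (r n).
elim/olt_ind: o n => o IH n on Dn an; subst o.
have [runi runs runl] := run n (conj Dn an).
have IHm m : rbefore m n -> exists2 c, stage x y (r m) c & codes m c.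
  move=> mn; have [Dm mn'] := (before_lt m Dn).1 mn.
  apply: (IH _ mn') => // k /(before_lt _ Dm)[Dk km]; apply: an; apply/before_lt => //.
  by split=> //; exact: olt_trans mn'.
have nh m c : rbefore m n -> codes m c -> ~~ halted c.
  by move=> mn mc; apply/negP => /(codes_halt mc); exact: an.
have [[nm n0]|[m [mn nm]]|[ln nl]] := node_cases Dn.
- exists (init_config T x y); first exact: stage_zero.
  exact: (runi nm).
- have [c sc cc] := IHm _ mn.1.
  exists (step c); first by apply: (stage_succ nm sc); exact: nh mn.1 cc.
  by apply/(codes_step n cc); exact: runs.
have /choice [h hP] : forall b, exists c : config T, olt b (r n) -> stage x y b c.
  move=> b; have [bn|nb] := pselect (olt b (r n)); last first.
    by exists (init_config T x y).
  have [m Dm mb] := rD Dn bn.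
  have [|c sc _] := IHm m; last by exists c => _; exact: stage_eq sc.
  by apply/before_lt => //; split=> //; exact: olt_eql (oeq_sym mb) bn.
exists (limit_config (r n) h); first exact: stage_limit.
apply/(codes_limit Dn hP) => [m mn|]; last exact: runl.
have [c sc cc] := IHm _ mn; have [Dm mn'] := (before_lt m Dn).1 mn.
by rewrite -(stage_det sc (oeq_refl _) (hP _ mn')).
Qed.

(** At a live node no earlier stage has halted, so the true stage exists there and satisfies the
    local condition. *)
Lemma run_complete : (forall n c, D n -> stage x y (r n) c -> codes n c) -> rrun.
Proof.
move=> sc n [Dn an].
have [c st] : exists c : config T, stage x y (r n) c.
  apply: stage_exists => b c bn sb; have [m Dm mb] := rD Dn bn.
  have mc := sc m c Dm (stage_eq (oeq_sym mb) sb).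
  apply/negP => /(codes_halt mc); apply: an; apply/before_lt => //.
  by split=> //; exact: olt_eql (oeq_sym mb) bn.
have cn := sc _ _ Dn st.
have stm m : rbefore m n -> exists2 c' : config T, stage x y (r m) c' & ~~ halted c'.
  by move=> /(before_lt _ Dn)[_ mn]; exact: (stage_before st mn).
split=> [nm|m [mn mi]|[ex lm]].
- have [[_ n0]|[m [[mn _] _]]|[[ex _] _]] := node_cases Dn; [|by case: nm; exists m|by []].
  apply/codes_init; suff <- : c = init_config T x y by [].
  by apply: (stage_det st n0); apply: stage_zero; exact: oeq_refl.
- have Dm : D m by case: mn.
  have nm : oeq (r n) (osucc (r m)).
    have [[[]]|[m' [[mn' mi'] nm']]|[[_ /(_ _ mn)[k [kn mk]]] _]] := node_cases Dn.
    + by exists m.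
    + apply: oeq_trans nm' _; have Dm' : D m' by case: mn'.
      have := mi _ mn'; have := mi' _ mn; rewrite !rR // -!oleNgt => h1 h2.
      by split; apply/ole_succP/olt_succP.
    + by case: (mi _ kn).
  have [c' sm nh] := stm _ mn; have cm := sc _ _ Dm sm.
  apply/(codes_step n cm); suff <- : c = step c' by [].
  by apply: (stage_det st nm); apply: stage_succ (oeq_refl _) sm nh.
have nl : olimit (r n).
  have [[]//|[m [[mn mi] _]]|[]//] := node_cases Dn.
  by have [k [kn km]] := lm _ mn; case: (mi _ kn).
have /choice [h hP] : forall b, exists c : config T, olt b (r n) -> stage x y b c.
  move=> b; have [bn|nb] := pselect (olt b (r n)); last first.
    by exists (init_config T x y).
  by have [c' sb _] := stage_before st bn; exists c'.
apply/(codes_limit Dn hP) => [m mn|].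
  by have [Dm mn'] := (before_lt m Dn).1 mn; apply: sc => //; exact: hP.
suff <- : c = limit_config (r n) h by [].
by apply: (stage_det st (oeq_refl _)); exact: stage_limit.
Qed.

End RunCode.

(** * The arithmetical formula of a run *)

Section RunFormula.
Variable T : ittm.

Definition set_name : countType := (bool + nat + ittm_state T + 'I_(ntapes T))%type.
(* Locked, since unification would otherwise compute the codes.               *)
Definition set_index (nu : set_name) : nat := locked (pickle nu).+1.
Definition ix_witness : nat := set_index (inl (inl (inl true))).
Definition ix_head : nat := set_index (inl (inl (inl false))).
Definition ix_order (k : nat) : nat := set_index (inl (inl (inr k))).
Definition ix_state (q : ittm_state T) : nat := set_index (inl (inr q)).
Definition ix_tape (i : 'I_(ntapes T)) : nat := set_index (inr i).

(** Number variables in what follows: 0 is the current node, 1 and 2 are nodes compared with it, 3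
    is a head position, 4 a cell, 5 the new head position. *)
Definition fdom u := MIn (TPair TZero (TVar u)) (ix_order 0).
Definition flt u v := MIn (TPair TOne (TPair (TVar u) (TVar v))) (ix_order 0).
Definition fin_state q v := MIn (TVar v) (ix_state q).
Definition fhead v h := MIn (TPair (TVar v) (TVar h)) ix_head.
Definition ftape i v p := MIn (TPair (TVar v) (TVar p)) (ix_tape i).

Definition fbefore u v := MAnd (fdom u) (flt u v).
Definition fhalt v := MOr (fin_state (q_accept T) v) (fin_state (q_reject T) v).
Definition falive := MAll 1 (MImp (fbefore 1 0) (MNot (fhalt 1))).
Definition fstate q := MConj (fun q' => MIff (fin_state q' 0) (MBool (q' == q))).
Definition fhome := MAll 3 (MIff (fhead 0 3) (MEq (TVar 3) TZero)).
Definition finput (i : 'I_(ntapes T)) : fm :=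
  match nat_of_ord i with
  | 0 => MIn (TVar 4) 0
  | 1 => MIn (TVar 4) ix_witness
  | _ => MBool false
  end.
Definition finit := MAnd (fstate (q_start T)) (MAnd fhome
  (MConj (fun i => MAll 4 (MIff (ftape i 0 4) (finput i))))).
Definition fmove (d : move) : fm :=
  match d with
  | MoveL => MOr (MEq (TAdd (TVar 5) TOne) (TVar 3))
               (MAnd (MEq (TVar 3) TZero) (MEq (TVar 5) TZero))
  | MoveR => MEq (TVar 5) (TAdd (TVar 3) TOne)
  end.
Definition fresult (t : ittm_state T * (ntapes T).-tuple bool * move) : fm :=
  MAnd (fstate t.1.1) (MAnd (MAll 5 (MIff (fhead 0 5) (fmove t.2)))
    (MConj (fun i => MAll 4 (MIff (ftape i 0 4)
      (MOr (MAnd (MEq (TVar 4) (TVar 3)) (MBool (tnth t.1.2 i)))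
         (MAnd (MNot (MEq (TVar 4) (TVar 3))) (ftape i 1 4))))))).
Definition fstep := MConj (fun q => MConj (fun w : (ntapes T).-tuple bool => MAll 3
  (MImp (MAnd (fin_state q 1) (MAnd (fhead 1 3)
           (MConj (fun i => MIff (ftape i 1 3) (MBool (tnth w i))))))
     (fresult (ittm_trans q w))))).
Definition flimit := MAnd (fstate (q_limit T)) (MAnd fhome
  (MConj (fun i => MAll 4 (MIff (ftape i 0 4) (MAll 1 (MImp (fbefore 1 0)
    (MEx 2 (MAnd (fbefore 2 0) (MAnd (MNot (flt 2 1)) (ftape i 2 4)))))))))).
Definition frun := MAll 0 (MImp (MAnd (fdom 0) falive)
  (MAnd (MImp (MNot (MEx 1 (fbefore 1 0))) finit)
  (MAnd (MAll 1 (MImp (MAnd (fbefore 1 0)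
                    (MAll 2 (MImp (fbefore 2 0) (MNot (flt 1 2))))) fstep))
    (MImp (MAnd (MEx 1 (fbefore 1 0))
                (MAll 1 (MImp (fbefore 1 0) (MEx 2 (MAnd (fbefore 2 0) (flt 1 2))))))
       flimit)))).
Definition faccept := MEx 0 (MAnd (MAnd (fdom 0) falive) (fin_state (q_accept T) 0)).

Variable X : nat -> real.
Definition cD n : Prop := X (ix_order 0) (cpair 0 n).
Definition cR m n : Prop := X (ix_order 0) (cpair 1 (cpair m n)).
Definition cS q n : Prop := X (ix_state q) n.
Definition cH n h : Prop := X ix_head (cpair n h).
Definition cC i n p : Prop := X (ix_tape i) (cpair n p).

Lemma and3E (P Q R : Prop) : P /\ (Q /\ R) <-> [/\ P, Q & R].
Proof. by split=> [[? []]|[]]. Qed.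

Lemma fsat_init n :
  fsat X (upd e0 0 n) finit <-> rinit (X 0) (X ix_witness) cS cH cC n.
Proof.
rewrite /rinit -and3E.
(* Evaluation at concrete variable names computes, so formula and predicate agree by conversion up
   to the input clause. *)
change ((rstate cS (q_start T) n /\ (forall h, cH n h <-> h = 0) /\
  forall i p, cC i n p <-> fsat X (upd (upd e0 0 n) 4 p) (finput i)) <->
  rstate cS (q_start T) n /\ (forall h, cH n h <-> h = 0) /\
  forall i p, cC i n p <-> nth blank [:: X 0; X ix_witness] i p).
have E i p : fsat X (upd (upd e0 0 n) 4 p) (finput i) <->
    nth blank [:: X 0; X ix_witness] i p.
  by rewrite /finput; case: (nat_of_ord i) => [|[|j]] //=; rewrite nth_nil.
split=> -[hs [hh h]]; (split; [exact: hs|split; [exact: hh|move=> i p]]).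
  exact: iff_trans (h i p) (E i p).
exact: iff_trans (h i p) (iff_sym (E i p)).
Qed.

Lemma fsat_step n m :
  fsat X (upd (upd e0 0 n) 1 m) fstep <-> rstep cS cH cC m n.
Proof.
have ME h h' d : fsat X (upd (upd (upd (upd e0 0 n) 1 m) 3 h) 5 h') (fmove d) <->
    rmove d h' h by case: d.
change ((forall q (w : (ntapes T).-tuple bool) h,
    cS q m /\ (cH m h /\ forall i, cC i m h <-> tnth w i) ->
    let t := ittm_trans q w in
    rstate cS t.1.1 n /\ ((forall h', cH n h' <->
       fsat X (upd (upd (upd (upd e0 0 n) 1 m) 3 h) 5 h') (fmove t.2)) /\
      forall i p, cC i n p <-> (p = h /\ tnth t.1.2 i) \/ (~ p = h /\ cC i m p))) <->
  rstep cS cH cC m n).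
split=> H q w h hq; have := H q w h hq.
  by move=> /= [? [h2 ?]]; split=> // h'; rewrite h2 ME.
by move=> /= [? h2 ?]; split=> //; split=> // h'; rewrite h2 ME.
Qed.

Lemma fsat_limit n :
  fsat X (upd e0 0 n) flimit <-> rlimit cD cR cS cH cC n.
Proof. by rewrite /rlimit -and3E. Qed.

Lemma fsat_run :
  fsat X e0 frun <-> rrun (X 0) (X ix_witness) cD cR cS cH cC.
Proof.
change ((forall n, cD n /\ ralive cD cR cS n ->
  (~ (exists m, rbefore cD cR m n) -> fsat X (upd e0 0 n) finit) /\
  ((forall m, rbefore cD cR m n /\ (forall k, rbefore cD cR k n -> ~ cR m k) ->
      fsat X (upd (upd e0 0 n) 1 m) fstep) /\
   ((exists m, rbefore cD cR m n) /\
     (forall m, rbefore cD cR m n -> exists k, rbefore cD cR k n /\ cR m k) ->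
     fsat X (upd e0 0 n) flimit))) <->
  rrun (X 0) (X ix_witness) cD cR cS cH cC).
split=> H n /H.
  move=> [h1 [h2 h3]]; split.
  - by move=> /h1/fsat_init.
  - by move=> m /h2/fsat_step.
  - by move=> /h3/fsat_limit.
move=> [h1 h2 h3]; split; first by move=> /h1/fsat_init.
split; first by move=> m /h2/fsat_step.
by move=> /h3/fsat_limit.
Qed.

Lemma fsat_accept : fsat X e0 faccept <-> raccept cD cR cS.
Proof. by []. Qed.

End RunFormula.

(** The guess consists of y, a solution of the formula that pins down a well-order of type above the
    time bound, and the tables of states, heads and cells along it. *)
Lemma NP_Sigma11 a : covered a -> NP_ a `<=` Sigma11.
Proof.
move=> ca A [T [b [ba hb hA]]]; have [a' ba' [p [[W hW] hp]]] := ca b ba.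
apply: (Sigma11_intro (p := MAnd (fren (@ix_order T) p) (MAnd (frun T) (faccept T)))) => x.
rewrite hA; split=> [[y [a0 [c [sc qc]]]]|[X]].
  have hc : halted c by rewrite /halted qc inE eqxx.
  have [g [gb [c' [sc' hc']]]] := hb x y.
  have [ag _] := halted_stage_uniq sc sc' hc hc'.
  (* The accepting stage is g + 1 with g < [b], hence at most [b] and strictly below [a'], so it has
     a notation. *)
  have a0a : olt a0 a'.
    apply: (olt_eql (oeq_sym ag)); apply: ole_lt_trans ba'; exact/ole_succP.
  have [r [r1 r2 r3]] := hp _ hW.
  have [Hd hHd] := rel_real (fun n h =>
    exists2 c : config T, stage x y (r n) c & c_head c = h).
  have /choice [Ct hCt] : forall i, exists Z : real, forall n q, Z (cpair n q) <->
      exists2 c : config T, stage x y (r n) c & c_tape c i q.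
    by move=> i; exact: rel_real.
  pose St q n := `[< exists2 c : config T, stage x y (r n) c & c_state c = q >].
  pose F (nu : set_name T) : real := match nu with
    | inl (inl (inl true)) => y
    | inl (inl (inl false)) => Hd
    | inl (inl (inr k)) => W k
    | inl (inr q) => St q
    | inr i => Ct i
    end.
  have [X' XE'] : exists X', forall nu, scons x X' (set_index nu) = F nu.
    exists (fun z => if unpickle z is Some nu then F nu else blank) => nu.
    by rewrite /set_index -lock /= pickleK.
  have [X [X0 XE]] : exists X, X = scons x X' /\ forall nu, X (set_index nu) = F nu.
    by exists (scons x X').
  have cDE n : cD T X n = W 0 (cpair 0 n) by rewrite /cD XE.
  have rR m n : cD T X m -> cD T X n -> (cR T X m n <-> olt (r m) (r n)).
    by rewrite !cDE /cR XE; exact: r2.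
  have rD n o : cD T X n -> olt o (r n) -> exists2 m, cD T X m & oeq (r m) o.
    rewrite cDE => /r1 na no; have [|m] := r3 o; first exact: olt_trans na.
    by exists m => //; rewrite cDE.
  have cd n d : cD T X n -> stage x y (r n) d ->
      codes (cS (T := T) X) (cH T X) (cC (T := T) X) n d.
    move=> _ sd; have dE d' : stage x y (r n) d' -> d' = d.
      by move=> sd'; exact: stage_det sd' _ _ (oeq_refl _) sd.
    split.
    - move=> q; rewrite /cS XE; split=> [/asboolP[d' /dE-> ->]//|/eqP->].
      by apply/asboolP; exists d.
    - move=> h; rewrite /cH XE hHd; split=> [[d' /dE-> ->]//|->].
      by exists d.
    - move=> i q; rewrite /cC XE hCt; split=> [[d' /dE->]//|h].
      by exists d.
  exists X'; rewrite -X0; split; last split.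
  - apply/fsat_ren; suff -> : X \o @ix_order T = W by [].
    by apply/funext => k; exact: XE.
  - apply/fsat_run; rewrite XE.
    have -> : X 0 = x by rewrite X0.
    exact: (run_complete rR rD cd).
  apply/fsat_accept; have [n Wn na0] := r3 _ a0a.
  have Dn : cD T X n by rewrite cDE.
  have sn := stage_eq (oeq_sym na0) sc.
  have cn := cd _ _ Dn sn.
  exists n; split; last by case: cn => h _ _; apply/h; rewrite qc.
  split=> // m /(before_lt rR _ Dn)[Dm mn].
  have [d sd nd] := stage_before sn mn.
  by move/(codes_halt (cd _ _ Dm sd)); apply/negP.
move=> [/fsat_ren/hp [r [r1 r2 r3]] [/fsat_run run /fsat_accept [n [[Dn an] qn]]]].
have rD m o : cD T (scons x X) m -> olt o (r m) ->
    exists2 k, cD T (scons x X) k & oeq (r k) o.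
  by move=> /r1 ma mo; apply: r3; exact: olt_trans ma.
have [c sc [cs _ _]] := run_sound r2 rD run Dn an.
exists (scons x X (ix_witness T)), (r n), c; split=> //.
by apply/esym/eqP/cs.
Qed.

Lemma Pi11_setC A : Pi11 A <-> Sigma11 (~` A).
Proof.
split=> [[p hp]|[p hp]]; exists (FNot p) => x; rewrite /setC /mkset.
  rewrite hp; split=> [/existsNP[y hy]|[y hy] h]; [by exists y|exact: hy (h y)].
split=> [Ax y hy|h].
  by have /hp := ex_intro (fun y => sat2 p x y) y hy.
by apply: contrapT => /hp[y hy]; exact: (h y).
Qed.

Lemma NP_eq a : olt (osucc omega) a -> covered a -> NP_ a = Sigma11.
Proof.
by move=> wa ca; apply/seteqP; split; [exact: NP_Sigma11|exact: Sigma11_NP].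
Qed.

Lemma coNP_eq a : olt (osucc omega) a -> covered a -> coNP_ a = Pi11.
Proof.
move=> wa ca; apply/seteqP; split=> A; rewrite /coNP_ /mkset NP_eq //.
  by move=> /Pi11_setC.
by move=> /Pi11_setC.
Qed.

Theorem theorem3p2 :
  (forall a : ord, ole (oadd omega (onat 2)) a -> ole a omega1ck ->
     NP_ a = Sigma11 /\ coNP_ a = Pi11)
  /\ NP = NP_ (oadd omega (onat 2))
  /\ NP `&` coNP = Delta11.
Proof.
(* Coverage of omega ^ omega by the orders omega ^ j settles [NP] without comparing omega ^ omega
   with [omega1ck]. *)
have cw := covered_omega_omega; have lw := omega_succ_lt.
split; [|split].
- move=> a wa ack; have sa := olt_le_trans omega_succ_lt2 wa.
  have ca := covered_le ack covered_omega1ck.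
  by split; [exact: NP_eq|exact: coNP_eq].
- rewrite /NP NP_eq // NP_eq //; first exact: omega_succ_lt2.
  exact: covered_le omega2_le cw.
by rewrite /NP /coNP NP_eq // coNP_eq.
Qed.
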